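(* $\overline{\mathcal{EO}}(8n+6)$ is almost always divisible by $8$, namely, $$\lim_{X\to\infty} \frac{\# \left\{0\leq n\leq X: \overline{\mathcal{EO}}(8n+6)\equiv 0\pmod{8}\right\}}{X}=1,$$ where $n$ ranges over integers.
   Context: For a nonnegative integer $n$, $\mathcal{EO}(n)$ is the number of partitions of $n$ in which every even part is less than each odd part. $\overline{\mathcal{EO}}(n)$ is the number of partitions counted by $\mathcal{EO}(n)$ in which only the largest even part appears an odd number of times (that is, if the partition has an even part, then the largest even part appears an odd number of times and every other part size that occurs appears an even number of times; if there are no even parts, every part size that occurs appears an even number of times). For example $\overline{\mathcal{EO}}(8)=5$, the relevant partitions being $8$, $4+2+2$, $3+3+2$, $3+3+1+1$, $1+1+1+1+1+1+1+1$. Equivalently (Andrews), $\overline{\mathcal{EO}}(n)$ is given by the generating function $$\sum_{n=0}^{\infty}\overline{\mathcal{EO}}(n)q^n=\frac{(q^4; q^4)_{\infty}^3}{(q^2; q^2)_{\infty}^2},\qquad (a; q)_{\infty}:=\prod_{m\geq 0}(1-aq^m).$$ *)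

(* Defs.v *)
From HB Require Import structures.
From mathcomp Require Import all_boot all_order all_algebra.
From mathcomp Require Import finmap.
From mathcomp Require Import all_classical all_reals all_analysis.

Set Implicit Arguments.
Unset Strict Implicit.
Unset Printing Implicit Defensive.

Import Order.TTheory GRing.Theory Num.Theory.
Import numFieldNormedType.Exports.

Local Open Scope nat_scope.

(* A partition of n is encoded by its multiplicities: m i is the number of
   occurrences of the part i. Parts and multiplicities never exceed n, and 0 is
   not a part. *)
Definition is_partition (n : nat) (m : {ffun 'I_n.+1 -> 'I_n.+1}) : bool :=
  (m ord0 == 0 :> nat) && (\sum_(i < n.+1) i * m i == n).

Definition is_part (n : nat) (m : {ffun 'I_n.+1 -> 'I_n.+1}) (i : 'I_n.+1) :
  bool := 0 < m i.

Definition even_lt_odd (n : nat) (m : {ffun 'I_n.+1 -> 'I_n.+1}) : bool :=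
  [forall i : 'I_n.+1, forall j : 'I_n.+1,
     [&& is_part m i, ~~ odd i, is_part m j & odd j] ==> (i < j)].

Definition is_largest_even_part (n : nat) (m : {ffun 'I_n.+1 -> 'I_n.+1})
    (i : 'I_n.+1) : bool :=
  [&& is_part m i, ~~ odd i &
      [forall j : 'I_n.+1, (is_part m j && ~~ odd j) ==> (j <= i)]].

Definition EO_partitions (n : nat) : {set {ffun 'I_n.+1 -> 'I_n.+1}} :=
  [set m | is_partition m && even_lt_odd m].

(* If there is no even part, every multiplicity must be even. *)
Definition EObar_partitions (n : nat) : {set {ffun 'I_n.+1 -> 'I_n.+1}} :=
  [set m in EO_partitions n |
     [forall i : 'I_n.+1, odd (m i) == is_largest_even_part m i]].

Definition EObar (n : nat) : nat := #|EObar_partitions n|.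

(* Number of natural numbers n <= X with property P, X being real. The set is
   always finite, so fset_set is its genuine enumeration. *)
Definition count_upto (R : realType) (P : nat -> Prop) (X : R) : nat :=
  (#|` fset_set [set n : nat | (n%:R <= X)%R /\ P n]%classic|)%fset.

(* Main.v *)
Require Import Defs.
From mathcomp Require Import all_boot all_order all_algebra.
From mathcomp Require Import all_classical all_reals all_analysis.
From mathcomp Require Import finmap finfield qpoly polydiv ring lra zify.
Import Order.TTheory GRing.Theory Num.Theory.
Import numFieldNormedType.Exports.
Set Implicit Arguments.
Unset Strict Implicit.
Unset Printing Implicit Defensive.
Local Open Scope classical_set_scope.
Local Open Scope ring_scope.

(** Write f_k for the product of the 1 - q^(k i), i >= 1, psi(q) for the sum of
    the q^T over the triangular numbers T, and phi(-q) = 1 + 2 theta(q) for the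
    sum of the (-1)^k q^(k^2) over all integers k.

    Sorting the partitions by their largest even part and summing with the
    q-binomial theorem gives the generating function f_2^3 / f_1^2 for the
    EObar(2 n), which Gauss's product phi(-q) = f_1^2 / f_2 turns into
    f_4 phi(-q^2) / phi(-q) ([EObar_genfun]).  Modulo 8 the inverse of
    1 + 2 theta is 1 - 2 theta + 4 theta^2.  Squares are 0 or 1 modulo 4, so
    only the odd squares of theta(q) and of theta(q^2) meet in the exponents
    4 n + 3, and they do so with the factor 4: EObar(8 n + 6) is, up to sign, 4
    times the n-th coefficient of f_1 psi(q^2) psi(q^4) modulo 8
    ([EObar_coef_mod8]).  Modulo 2 one has f_(2k) = f_k^2 and psi = f_1 f_2,
    hence f_1 psi(q^2) psi(q^4) = psi(q) f_16, and Euler's pentagonal number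
    theorem expands f_16.  Completing squares in the exponents, EObar(8 n + 6)
    can fail to be divisible by 8 only if 24 n + 19 = 3 a^2 + 16 b^2
    ([not_dvd8_EObar]).

    Such numbers have density zero.  Three times such a number is
    (3 a)^2 + 3 (4 b)^2, a norm from the Eisenstein integers, so no prime
    p > 2 with p = 2 modulo 3 divides it exactly once ([inert_dvd_form]).  By
    the Chinese remainder theorem the n that survive this test for finitely many
    p have density the product of the 1 - 1/p + 1/p^2 ([sieve_count]), which is
    as small as desired as soon as the sum of the 1/p over these p diverges.
    The divergence needs no value of an L-function: the partial sums of the
    chi(k)/k, for chi the nontrivial character modulo 3, are at most 1, and
    changing chi(p) into 1 for one prime p after the other multiplies the bound
    by at most (1 + 1/p) / (1 - 1/p) and ends with the harmonic series
    ([chi3_sum_le], [inert_product_small]).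

    Power series are handled without limits: the identities are proved in an
    arbitrary commutative ring for a nilpotent q, where all the products and
    sums are finite, and are read off in the polynomials modulo X^N. *)

(** * Gaussian binomials and the triple product for a nilpotent base *)

(** The q-Pochhammer symbol (q; q)_n. *)
Definition qpoch (A : pzRingType) (q : A) (n : nat) : A :=
  \prod_(i < n) (1 - q ^+ i.+1).

Fixpoint qbinom (A : pzRingType) (q : A) (m k : nat) : A :=
  match m, k with
  | _, 0 => 1
  | 0, _.+1 => 0
  | m'.+1, k'.+1 => qbinom q m' k' + q ^+ k'.+1 * qbinom q m' k'.+1
  end.

Arguments qbinom : simpl never.

Section QSeries.
Variable A : comNzRingType.
Implicit Types q u v z a : A.

Lemma qbinom0 q m : qbinom q m 0 = 1. Proof. by case: m. Qed.

Lemma qbinomS q m k :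
  qbinom q m.+1 k.+1 = qbinom q m k + q ^+ k.+1 * qbinom q m k.+1.
Proof. by []. Qed.

Lemma qbinom_small q m k : (m < k)%N -> qbinom q m k = 0.
Proof.
elim: m k => [|m IH] [|k] //= lt_mk.
by rewrite qbinomS !IH ?mulr0 ?addr0 // ltnW.
Qed.

Lemma qbinom_diag q m : qbinom q m m = 1.
Proof. by elim: m => // m IH; rewrite qbinomS IH qbinom_small // mulr0 addr0. Qed.

Lemma qpochS q n : qpoch q n.+1 = qpoch q n * (1 - q ^+ n.+1).
Proof. by rewrite /qpoch big_ord_recr. Qed.

(** The quotient formula for Gaussian binomials, free of division.  For a
    nilpotent q all the long factorials agree and are invertible, so it makes
    the central Gaussian binomials equal to the inverse of the infinite
    product. *)
Lemma qbinom_fact q m k :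
  qbinom q (m + k) k * (qpoch q k * qpoch q m) = qpoch q (m + k).
Proof.
have [n le_n] := ubnP (m + k)%N; elim: n => // n IH in m k le_n *.
case: k => [|k] in le_n *.
  by rewrite qbinom0 addn0 /qpoch big_ord0 !mul1r.
case: m => [|m] in le_n *.
  by rewrite add0n qbinom_diag /qpoch big_ord0 mulr1 mul1r.
have IH1 := IH m.+1 k ltac:(lia).
have IH2 := IH m k.+1 ltac:(lia).
rewrite addnS qbinomS [RHS]qpochS -[in RHS]addnS.
have -> : q ^+ (m + k.+1).+1 = q ^+ m.+1 * q ^+ k.+1.
  by rewrite -exprD; congr (_ ^+ _); lia.
rewrite addSnnS in IH1 *; rewrite qpochS in IH2; rewrite qpochS in IH1.
rewrite !qpochS.
set x := q ^+ k.+1 in IH2 *; set y := q ^+ m.+1 in IH1 *.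
transitivity ((1 - x) * qpoch q (m + k.+1) + x * (1 - y) * qpoch q (m + k.+1)).
  by rewrite -{1}IH1 -IH2; ring.
by ring.
Qed.

(** The second Pascal rule: the recursion that defines [qbinom] absorbs a new
    factor on one side of the triple product, this one on the other side. *)
Lemma qbinomSr q m k : (k <= m)%N ->
  qbinom q m.+1 k.+1 = q ^+ (m - k) * qbinom q m k + qbinom q m k.+1.
Proof.
elim: m k => [|m IH] k le_km.
  move: le_km; rewrite leqn0 => /eqP ->.
  by rewrite !qbinom_diag qbinom_small // addr0 mulr1.
case: k => [|k] in le_km *.
  rewrite qbinomS [in LHS](IH 0%N isT) [qbinom q m.+1 1]qbinomS.
  by rewrite !qbinom0 !subn0 expr1 !mulr1 exprS; ring.
have le_km' : (k <= m)%N by [].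
rewrite qbinomS [in LHS](IH k le_km') [qbinom q m.+1 k.+1]qbinomS.
have [lt_km | ge_km] := ltnP k m; last first.
  have -> : k = m by apply/eqP; rewrite eqn_leq le_km'.
  by rewrite !subnn qbinom_diag !qbinom_small //; ring.
rewrite [in LHS](IH k.+1 lt_km) [qbinom q m.+1 k.+2]qbinomS subSS.
have -> : (m - k = (m - k.+1).+1)%N by lia.
have e : q ^+ k.+2 * q ^+ (m - k.+1) = q ^+ (m - k.+1).+1 * q ^+ k.+1.
  by rewrite -!exprD; congr (_ ^+ _); lia.
by rewrite mulrDr mulrA e; ring.
Qed.

(** The general term of the theta series of u and v, with q = u v: index j
    stands for the exponent k = j - m, the power of u for k >= 0 and of v for
    k < 0, so that the series over all integers is indexed by nat. *)
Definition theta_term u v (m j : nat) : A :=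
  if (m <= j)%N then u ^+ (j - m) * (u * v) ^+ 'C(j - m, 2)
  else v ^+ (m - j) * (u * v) ^+ 'C(m - j, 2).

Lemma theta_termSS u v m j : theta_term u v m.+1 j.+1 = theta_term u v m j.
Proof. by rewrite /theta_term ltnS !subSS. Qed.

Lemma theta_term_mulu u v n m j : (j <= n + m)%N ->
  (u * v) ^+ n * u * theta_term u v m j = (u * v) ^+ (n + m - j) * theta_term u v m j.+1.
Proof.
move=> le_j; rewrite /theta_term; have [le_mj | lt_jm] := leqP m j.
  rewrite (leqW le_mj) subSn // binS bin1 exprD.
  have -> : (u * v) ^+ n = (u * v) ^+ (n + m - j) * (u * v) ^+ (j - m).
    by rewrite -exprD; congr (_ ^+ _); lia.
  by rewrite exprS; ring.
have -> : (m - j = (m - j.+1).+1)%N by lia.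
rewrite binS bin1 exprD.
have -> : (u * v) ^+ (n + m - j)
        = (u * v) ^+ n * (u * v) * (u * v) ^+ (m - j.+1).
  by rewrite -exprSr -exprD; congr (_ ^+ _); lia.
have [le_mj' | lt_jm'] := leqP m j.+1.
  have -> : (m - j.+1 = 0)%N by lia.
  have -> : (j.+1 - m = 0)%N by lia.
  by rewrite !expr0 !mulr1 expr1; ring.
by rewrite exprS; ring.
Qed.

Lemma theta_term_mulv u v m j :
  (u * v) ^+ m * v * theta_term u v m j = (u * v) ^+ j * theta_term u v m.+1 j.
Proof.
rewrite /theta_term; have [le_mj | lt_jm] := leqP m j; last first.
  rewrite ltnNge (ltnW lt_jm) /= subSn 1?ltnW // binS bin1 exprD.
  have -> : (u * v) ^+ m = (u * v) ^+ j * (u * v) ^+ (m - j).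
    by rewrite -exprD; congr (_ ^+ _); lia.
  by rewrite exprS; ring.
have [lt_mj | ge_mj] := ltnP m j; last first.
  have -> : j = m by lia.
  by rewrite subnn subSnn; ring.
have -> : (j - m = (j - m.+1).+1)%N by lia.
rewrite binS bin1 exprD.
have -> : (u * v) ^+ j = (u * v) ^+ m * (u * v) * (u * v) ^+ (j - m.+1).
  by rewrite -exprSr -exprD; congr (_ ^+ _); lia.
by rewrite exprS; ring.
Qed.

(** Jacobi's triple product before the passage to the limit.  Writing it with u
    and v, where u v = q, avoids the negative powers of the usual variable z;
    each new factor is absorbed by one of the two Pascal rules. *)
Lemma finite_triple_product u v n m :
  \prod_(i < n) (1 + u * (u * v) ^+ i) * \prod_(i < m) (1 + v * (u * v) ^+ i)
  = \sum_(j < (n + m).+1) qbinom (u * v) (n + m) j * theta_term u v m j.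
Proof.
elim: n => [|n IHn].
  rewrite big_ord0 mul1r; elim: m => [|m IHm].
    by rewrite big_ord0 big_ord1 /theta_term qbinom_diag subnn bin_small // !expr0 !mulr1.
  rewrite big_ord_recr /= IHm !add0n mulrDr mulr1 [v * _]mulrC.
  rewrite [in RHS]big_ord_recl /= qbinom0 mul1r.
  under [in RHS]eq_bigr => j _.
    rewrite /bump add1n qbinomS mulrDl theta_termSS.
    over.
  rewrite big_split /= addrCA; congr (_ + _).
  rewrite mulr_suml.
  transitivity (\sum_(i < m.+1)
      qbinom (u * v) m i * ((u * v) ^+ i * theta_term u v m.+1 i)).
    by apply: eq_bigr => i _; rewrite -theta_term_mulv; ring.
  rewrite big_ord_recl /= qbinom0 expr0 !mul1r; congr (_ + _).
  rewrite [in RHS]big_ord_recr /= qbinom_small // mulr0 mul0r addr0.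
  by apply: eq_bigr => i _; rewrite /bump !add1n theta_termSS; ring.
rewrite big_ord_recr /= mulrAC IHn mulrDr mulr1 addSn.
rewrite [in RHS]big_ord_recl /= qbinom0 mul1r.
under [in RHS]eq_bigr => j _.
  rewrite /bump add1n qbinomSr -1?ltnS // mulrDl.
  over.
rewrite big_split /= addrCA addrC; congr (_ + _); last first.
  rewrite mulr_suml; apply: eq_bigr => i _.
  have le_i : (i <= n + m)%N by rewrite -ltnS.
  rewrite [_ * qbinom _ _ _]mulrC -!mulrA -(theta_term_mulu u v le_i).
  by ring.
rewrite [in LHS]big_ord_recl qbinom0 mul1r; congr (_ + _).
rewrite [in RHS]big_ord_recr /= qbinom_small // mul0r addr0.
by apply: eq_bigr => i _.
Qed.

Section Nilpotent.
Variables (q : A) (N : nat).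
Hypothesis q_nil : q ^+ N = 0.

Lemma nil_expr_ge k : (N <= k)%N -> q ^+ k = 0.
Proof. by move=> le_Nk; rewrite -(subnK le_Nk) exprD q_nil mulr0. Qed.

Lemma nil_expr k : (0 < k)%N -> (q ^+ k) ^+ N = 0.
Proof. by move=> k_gt0; rewrite -exprM nil_expr_ge // leq_pmull. Qed.

(** Products whose factors are eventually 1 need not be truncated at matching
    places; this is what replaces convergence. *)
Lemma nil_prod (F : nat -> A) m :
  (forall i, (N <= i)%N -> F i = 1 :> A) -> (N <= m)%N ->
  \prod_(i < m) F i = \prod_(i < N) F i.
Proof.
move=> F1 le_Nm; rewrite -(subnKC le_Nm) big_split_ord /=.
by rewrite [X in _ * X]big1 ?mulr1 // => i _; rewrite F1 // leq_addr.
Qed.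

Lemma qpoch_stable m : (N <= m)%N -> qpoch q m = qpoch q N.
Proof.
move=> le_Nm; apply: (nil_prod (F := fun i => 1 - q ^+ i.+1)) => // i le_Ni.
by rewrite nil_expr_ge ?subr0 // ltnW.
Qed.

Lemma geom_inv : (1 - q) * \sum_(j < N) q ^+ j = 1.
Proof. by rewrite -opprB mulNr -subrX1 q_nil sub0r opprK. Qed.
End Nilpotent.

Lemma qpoch_inv q N m : q ^+ N = 0 -> exists g, qpoch q m * g = 1.
Proof.
move=> q_nil; exists (\prod_(i < m) \sum_(j < N) (q ^+ i.+1) ^+ j).
rewrite -big_split big1 // => i _ /=.
by rewrite geom_inv // nil_expr.
Qed.

(** Jacobi's triple product.  In the finite form with 2 M factors, the Gaussian
    binomial of every term that is not already killed by nilpotency becomes the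
    inverse of [qpoch (u * v) N]. *)
Lemma triple_product u v N K : (u * v) ^+ N = 0 -> (N <= K)%N ->
  qpoch (u * v) N * (\prod_(i < N) (1 + u * (u * v) ^+ i)
                    * \prod_(i < N) (1 + v * (u * v) ^+ i))
  = 1 + \sum_(k < K) (u ^+ k.+1 + v ^+ k.+1) * (u * v) ^+ 'C(k.+1, 2).
Proof.
move=> q_nil le_NK; set q := u * v in q_nil *.
pose M := (N + K.+1)%N.
have prodM w : \prod_(i < M) (1 + w * q ^+ i) = \prod_(i < N) (1 + w * q ^+ i).
  apply: (@nil_prod N (fun i => 1 + w * q ^+ i)); last exact: leq_addr.
  by move=> i le_Ni; rewrite (nil_expr_ge q_nil) // mulr0 addr0.
rewrite -!prodM finite_triple_product -/q mulr_sumr.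
have tail k : (K < k)%N -> q ^+ 'C(k, 2) = 0.
  move=> lt_Kk; apply: nil_expr_ge q_nil _ _; case: k lt_Kk => [|k] // lt_Kk.
  by rewrite binS bin1 (leq_trans _ (leq_addl _ _)) //; lia.
have central j : (j <= M + M)%N -> (M - j <= K.+1)%N -> (j - M <= K.+1)%N ->
    qpoch q N * qbinom q (M + M) j = 1.
  move=> le_j le1 le2.
  have := qbinom_fact q (M + M - j) j; rewrite subnK //.
  rewrite !(qpoch_stable q_nil); [|lia|lia|lia] => E.
  have [g gE] := qpoch_inv N q_nil.
  transitivity (qpoch q N * g); last exact: gE.
  rewrite -{2}E; transitivity (qpoch q N * qbinom q (M + M) j * (qpoch q N * g)).
    by rewrite gE mulr1.
  by ring.
transitivity (\sum_(j < (M + M).+1) theta_term u v M j).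
  apply: eq_bigr => j _; rewrite mulrA.
  have le_j : (j <= M + M)%N by rewrite -ltnS.
  have [far | near] := leqP (maxn (M - j) (j - M)) K.+1.
    by rewrite central ?mul1r //; lia.
  by rewrite /theta_term -/q; case: leqP => le_Mj; rewrite tail ?mulr0 //; lia.
have -> : (M + M).+1 = (M + M.+1)%N by lia.
rewrite big_split_ord /= [X in _ + X]big_ord_recl /= addrCA; congr (_ + _).
  by rewrite /theta_term addn0 leqnn subnn bin_small // !expr0 mulr1.
rewrite [X in X + _](reindex_inj rev_ord_inj) /= -big_split /=.
have le_KM : (K <= M)%N by lia.
rewrite -(subnKC le_KM) big_split_ord /= subnKC // [X in _ + X]big1 ?addr0.
  apply: eq_bigr => k _; rewrite /theta_term /bump !add1n -/q.
  have -> : (M <= M - k.+1)%N = false by have := ltn_ord k; lia.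
  rewrite leq_addr.
  have -> : (M - (M - k.+1) = k.+1)%N by have := ltn_ord k; lia.
  by rewrite addKn; ring.
move=> k _; rewrite /theta_term /bump !add1n -/q leq_addr.
have lt_k := ltn_ord k.
have -> : (M <= M - (K + k).+1)%N = false by lia.
have -> : (M - (M - (K + k).+1) = (K + k).+1)%N by lia.
have -> : (M + (K + k).+1 - M = (K + k).+1)%N by lia.
by rewrite tail ?mulr0 ?addr0 //; lia.
Qed.
End QSeries.

(** * The q-binomial theorem and the classical theta identities *)

(** (q; q^2)_n, the product over the odd exponents. *)
Definition qodd (A : pzRingType) (q : A) (n : nat) : A :=
  \prod_(i < n) (1 - q ^+ i.*2.+1).

(** Half of phi(-q) - 1, for Ramanujan's phi. *)
Definition theta (A : pzRingType) (q : A) (K : nat) : A :=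
  \sum_(k < K) (-1) ^+ k.+1 * q ^+ (k.+1 ^ 2).

(** A partial sum of Ramanujan's psi, over the triangular numbers. *)
Definition psi (A : pzRingType) (q : A) (K : nat) : A :=
  \sum_(k < K) q ^+ 'C(k.+1, 2).

Lemma bin2_double k : (2 * 'C(k.+1, 2) = k.+1 * k)%N.
Proof. by rewrite mul_bin_left bin1; lia. Qed.

Section Theta.
Variable A : comNzRingType.
Implicit Types q u v z a p : A.

(** The functional equation of the series in w that proves the q-binomial
    theorem: subtracting the series at w p cancels the denominators of r. *)
Lemma q_binomial_step p a w K (r : nat -> A) :
  (forall k, r k.+1 * (1 - p ^+ k.+1) = r k * (1 - a * p ^+ k)) ->
  w ^+ K = 0 ->
  (1 - w) * \sum_(k < K) r k * w ^+ k
  = (1 - a * w) * \sum_(k < K) r k * (w * p) ^+ k.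
Proof.
move=> rS w_nil.
suff E : \sum_(k < K) r k * w ^+ k - \sum_(k < K) r k * (w * p) ^+ k
       = w * (\sum_(k < K) r k * w ^+ k - a * \sum_(k < K) r k * (w * p) ^+ k).
  set G := \sum_(k < K) r k * w ^+ k in E *.
  set G' := \sum_(k < K) _ in E *.
  have -> : (1 - w) * G = (1 - a * w) * G' + (G - G' - w * (G - a * G')) by ring.
  by rewrite E subrr addr0.
transitivity (\sum_(k < K.+1) r k * (1 - p ^+ k) * w ^+ k).
  rewrite big_ord_recr /= w_nil mulr0 addr0 -sumrB.
  by apply: eq_bigr => k _; rewrite exprMn; ring.
rewrite big_ord_recl /= expr0 subrr mulr0 mul0r add0r.
rewrite mulr_sumr -sumrB mulr_sumr; apply: eq_bigr => k _.
by rewrite /bump add1n rS exprMn exprS; ring.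
Qed.

(** The q-binomial theorem, with r k = (a; p)_k / (p; p)_k described by its
    recursion so that no division is needed. *)
Lemma q_binomial p a z N (r : nat -> A) :
  r 0%N = 1 ->
  (forall k, r k.+1 * (1 - p ^+ k.+1) = r k * (1 - a * p ^+ k)) ->
  p ^+ N = 0 -> z ^+ N.+1 = 0 ->
  \prod_(j < N) (1 - z * p ^+ j) * \sum_(k < N.+1) r k * z ^+ k
  = \prod_(j < N) (1 - a * z * p ^+ j).
Proof.
move=> r0 rS p_nil z_nil.
pose G j := \sum_(k < N.+1) r k * (z * p ^+ j) ^+ k.
have -> : \sum_(k < N.+1) r k * z ^+ k = G 0%N.
  by apply: eq_bigr => k _; rewrite mulr1.
have step n : \prod_(j < n) (1 - z * p ^+ j) * G 0%N
            = \prod_(j < n) (1 - a * z * p ^+ j) * G n.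
  elim: n => [|n IH]; first by rewrite !big_ord0.
  rewrite !big_ord_recr /= mulrAC IH -!mulrA; congr (_ * _).
  rewrite [LHS]mulrC (q_binomial_step rS); last by rewrite exprMn z_nil mul0r.
  by rewrite /G -mulrA -exprSr mulrA.
rewrite step -[RHS]mulr1; congr (_ * _).
rewrite /G big_ord_recl r0 mul1r expr0 big1 ?addr0 // => k _.
by rewrite p_nil mulr0 expr0n mulr0.
Qed.

Lemma qpoch_sqr_pchar2 q n : 2 \in [pchar A] ->
  qpoch (q ^+ 2) n = qpoch q n ^+ 2.
Proof.
move=> ch2; rewrite /qpoch -prodrXl; apply: eq_bigr => i _.
by rewrite -exprM mulnC exprM -!(pFrobenius_autE ch2) rmorphB rmorph1.
Qed.

Variables (q : A) (N : nat).
Hypothesis q_nil : q ^+ N = 0.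

Lemma qpoch_qodd : qpoch q N = qodd q N * qpoch (q ^+ 2) N.
Proof.
have E n : qpoch q n.*2 = qodd q n * qpoch (q ^+ 2) n.
  elim: n => [|n IH]; first by rewrite /qpoch /qodd !big_ord0 mulr1.
  rewrite doubleS !qpochS IH /qodd big_ord_recr /= -exprM mul2n; ring.
by rewrite -E (qpoch_stable q_nil) // -addnn leq_addr.
Qed.

(** Gauss: phi(-q) = f_1^2 / f_2, from the triple product with u = v = -q. *)
Lemma gauss_theta K : (N <= K)%N ->
  qodd q N ^+ 2 * qpoch (q ^+ 2) N = 1 + 2 * theta q K.
Proof.
move=> le_NK.
have e : (- q) * (- q) = q ^+ 2 by rewrite mulrNN.
have := @triple_product A (- q) (- q) N K.
rewrite e (nil_expr q_nil) // => /(_ erefl le_NK) E.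
transitivity (qpoch (q ^+ 2) N * (\prod_(i < N) (1 + - q * (q ^+ 2) ^+ i) *
              \prod_(i < N) (1 + - q * (q ^+ 2) ^+ i))).
  rewrite mulrC; congr (_ * _); rewrite expr2.
  have -> : qodd q N = \prod_(i < N) (1 + - q * (q ^+ 2) ^+ i) => //.
  by apply: eq_bigr => i _; rewrite mulNr -exprM mul2n exprS.
rewrite E; congr (_ + _); rewrite mulr_sumr; apply: eq_bigr => k _.
have -> : (k.+1 ^ 2 = k.+1 + 2 * 'C(k.+1, 2))%N.
  by rewrite bin2_double; lia.
by rewrite [in RHS]exprD exprM [(- q) ^+ _]exprNn; ring.
Qed.

(** The triple product with u = -q and v = -q^2 sorts the factors of f_1 by their
    exponents modulo 3. *)
Lemma euler_pentagonal K : (N <= K)%N ->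
  qpoch q N = 1 + \sum_(k < K) (-1) ^+ k.+1 *
    (q ^+ (k.+1 + 3 * 'C(k.+1, 2)) + q ^+ (2 * k.+1 + 3 * 'C(k.+1, 2))).
Proof.
move=> le_NK.
have e : (- q) * (- q ^+ 2) = q ^+ 3 by rewrite mulrNN -exprS.
have := @triple_product A (- q) (- q ^+ 2) N K.
rewrite e (nil_expr q_nil) // => /(_ erefl le_NK) E.
have E3 n : qpoch q (3 * n) = qpoch (q ^+ 3) n *
    (\prod_(i < n) (1 + - q * (q ^+ 3) ^+ i) *
     \prod_(i < n) (1 + - q ^+ 2 * (q ^+ 3) ^+ i)).
  elim: n => [|n IH]; first by rewrite /qpoch !big_ord0 !mulr1.
  have -> : (3 * n.+1 = (3 * n).+3)%N by lia.
  rewrite !qpochS IH !big_ord_recr /= -!exprM.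
  have -> : (3 * n.+1 = (3 * n).+3)%N by lia.
  by rewrite !exprS expr0; ring.
rewrite -(qpoch_stable q_nil (m := 3 * N)) ?E3 ?E ?leq_pmull //.
congr (_ + _); apply: eq_bigr => k _.
move: 'C(k.+1, 2) k.+1 => c l; rewrite [q ^+ (l + _)]exprD [q ^+ (2 * l + _)]exprD.
by rewrite !(exprM q) [(- q) ^+ _]exprNn [(- q ^+ 2) ^+ _]exprNn; ring.
Qed.

Lemma psi_stable K : (N <= K)%N -> psi q K = psi q N.
Proof.
move=> le_NK; rewrite /psi -(subnKC le_NK) big_split_ord /=.
rewrite [X in _ + X]big1 ?addr0 // => k _.
by rewrite (nil_expr_ge q_nil) // binS bin1; lia.
Qed.

(** Gauss's psi = f_2^2 / f_1 in characteristic 2, where f_2 = f_1^2.  The triple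
    product with u = q and v = q^3 produces each triangular number once, whereas
    u = 1 and v = q would give 2 psi, which is useless here. *)
Lemma gauss_psi_pchar2 K : 2 \in [pchar A] -> (N <= K)%N ->
  qpoch q N * qpoch (q ^+ 2) N = psi q K.
Proof.
move=> ch2 le_NK.
have opp (x : A) : - x = x by rewrite oppr_pchar2.
have e : q * q ^+ 3 = q ^+ 4 by rewrite -exprS.
have := @triple_product A q (q ^+ 3) N N.
rewrite e (nil_expr q_nil) // => /(_ erefl (leqnn _)) E.
have Eo n : \prod_(i < n) (1 + q * (q ^+ 4) ^+ i) *
     \prod_(i < n) (1 + q ^+ 3 * (q ^+ 4) ^+ i) = qodd q n.*2.
  elim: n => [|n IH]; first by rewrite /qodd !big_ord0 mulr1.
  rewrite /qodd doubleS !big_ord_recr /= -[X in _ = X * _ * _]IH !opp -exprM.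
  have -> : ((n.*2).*2.+1 = (4 * n).+1)%N by lia.
  have -> : ((n.*2.+1).*2.+1 = (4 * n).+3)%N by lia.
  by rewrite !exprS expr0; ring.
have odd_stable : qodd q N.*2 = qodd q N.
  apply: (nil_prod (F := fun i => 1 - q ^+ i.*2.+1)); last by lia.
  by move=> i le_i; rewrite (nil_expr_ge q_nil) ?subr0 //; lia.
have e4 : q ^+ 4 = (q ^+ 2) ^+ 2 by rewrite -exprM.
rewrite [in LHS]qpoch_qodd -odd_stable -Eo -mulrA -expr2.
rewrite -(qpoch_sqr_pchar2 _ _ ch2) -e4 mulrC E.
rewrite (psi_stable le_NK) -(psi_stable (K := N.*2.+1)); last by lia.
elim: (N) => [|n IH]; first by rewrite /psi big_ord0 big_ord1 addr0 bin_small.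
rewrite big_ord_recr /= addrA IH doubleS /psi 2![in RHS]big_ord_recr /= -addrA.
congr (_ + _); rewrite mulrDl -!exprM -!exprD; congr (_ ^+ _ + _ ^+ _).
  by have := bin2_double n; have := bin2_double n.*2.+1; nia.
by have := bin2_double n; have := bin2_double n.*2.+2; nia.
Qed.
End Theta.

(** * The generating function of the partitions *)

(** The polynomials modulo X^N: the place where q is nilpotent and coefficients
    of index less than N can still be read off. *)
Lemma truncated_polynomials (R : comNzRingType) (N : nat) : (0 < N)%N ->
  exists (A : comNzRingType) (pi : {rmorphism {poly R} -> A}),
    [/\ pi 'X ^+ N = 0, forall a, exists p, pi p = a
      & forall p p', pi p = pi p' -> forall i, (i < N)%N -> p`_i = p'`_i].
Proof.
move=> N_gt0; pose h : {poly R} := 'X^N.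
exists {poly %/ h}, (in_qpoly h : {rmorphism _ -> _}).
have hE : mk_monic h = 'X^N by rewrite /h mk_monic_Xn prednK.
have piE p : in_qpoly h p = Pdiv.Ring.rmodp p 'X^N :> {poly R} by rewrite /= hE.
have small (p : {poly R}) i : (i < N)%N -> p`_i = (Pdiv.Ring.rmodp p 'X^N)`_i.
  move=> lt_iN; rewrite {1}[p](Pdiv.RingMonic.rdivp_eq (monicXn R N)).
  by rewrite coefD coefMXn lt_iN add0r.
split=> [|a|p p' E i lt_iN].
- apply/val_inj; rewrite -rmorphXn; rewrite [LHS]piE.
  by rewrite (Pdiv.RingMonic.rmodpp (monicXn R N)).
- exists (a : {poly R}); apply/val_inj; apply: in_qpoly_small.
  exact: size_mk_monic.
by rewrite small // [RHS]small // -!piE E.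
Qed.

(** The multiplicities j allowed to the part i when the largest even part is L;
    L = 0 encodes a partition without even parts, and the part 0 is given
    multiplicity 0 in all cases.  The third test selects the even i < L and the
    odd i > L. *)
Definition EObar_mult (L i j : nat) : bool :=
  if i == 0%N then j == 0%N
  else if i == L then odd j
  else if (i < L)%N (+) odd i then ~~ odd j else j == 0%N.

Lemma EObar_mult_unique n (m : {ffun 'I_n.+1 -> 'I_n.+1}) (L L' : 'I_n.+1) :
  ~~ odd L -> ~~ odd L' ->
  (forall i : 'I_n.+1, EObar_mult L i (m i)) ->
  (forall i : 'I_n.+1, EObar_mult L' i (m i)) ->
  L = L'.
Proof.
wlog lt_LL' : L L' / (L < L')%N => [W eL eL' mL mL'|].
  case: (ltngtP L L') => [lt|lt|/val_inj //]; first exact: (W L L').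
  by apply/esym; apply: (W L' L).
move=> eL eL' /(_ L') mL /(_ L') mL'; exfalso; move: mL mL'.
rewrite /EObar_mult; have -> : (L' == 0%N :> nat) = false by lia.
have -> : (L' == L :> nat) = false by lia.
rewrite eqxx ltnNge (ltnW lt_LL') /= (negbTE eL').
by move=> /eqP ->.
Qed.

(** For a fixed largest even part the conditions on the different parts become
    independent, which is what turns the generating function into a sum of
    products. *)
Lemma EObar_partitionsP n (m : {ffun 'I_n.+1 -> 'I_n.+1}) :
  reflect (exists2 L : 'I_n.+1, ~~ odd L & forall i : 'I_n.+1, EObar_mult L i (m i))
    [&& (m ord0 == 0 :> nat)%N, even_lt_odd m &
        [forall i : 'I_n.+1, odd (m i) == is_largest_even_part m i]].
Proof.
apply: (iffP and3P) => [[m0 elo large]|[L eL mL]].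
  pose P (i : 'I_n.+1) := is_part m i && ~~ odd i.
  have [i0 Pi0|none] := pickP P.
    case: (@arg_maxnP _ i0 P (fun i => nat_of_ord i) Pi0) => L /andP[mL eL] maxL.
    have L_gt0 : (0 < L)%N.
      rewrite lt0n; apply/eqP => L0; move: mL; rewrite /is_part.
      have -> : L = ord0 by apply/val_inj.
      by rewrite (eqP m0).
    have largeL : is_largest_even_part m L.
      by rewrite /is_largest_even_part mL eL; apply/forallP => j; apply/implyP/maxL.
    exists L => // i; rewrite /EObar_mult.
    have [i0'|i_neq0] := eqVneq (i : nat) 0%N.
      by rewrite (ord_inj (i0' : i = ord0 :> nat)).
    have [iL|i_neqL] := eqVneq (i : nat) L.
      by rewrite (ord_inj iL) (eqP (forallP large L)).
    have notlarge : ~~ odd (m i).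
      rewrite (eqP (forallP large i)); apply/negP => /and3P[mi ei maxi].
      have := forallP maxi L; rewrite mL eL /= => le_Li.
      have : P i by rewrite /P mi ei.
      by move=> /maxL /= le_iL; move/eqP: i_neqL; apply; apply/eqP; rewrite eqn_leq le_iL.
    case: ifP => // cond; rewrite -leqn0 leqNgt; apply/negP => mi.
    move: cond; have [oi|ei] := boolP (odd i).
      have /implyP := forallP (forallP elo L) i.
      by rewrite mL eL oi; rewrite /is_part mi => /(_ isT) lt_Li; rewrite ltnNge ltnW.
    have : P i by rewrite /P /is_part mi ei.
    by move=> /maxL /= le_iL; rewrite addbF ltn_neqAle i_neqL le_iL.
  exists ord0 => // i; rewrite /EObar_mult.
  have [i0'|i_neq0] := eqVneq (i : nat) 0%N.
    by rewrite (ord_inj (i0' : i = ord0 :> nat)).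
  rewrite ltn0 /=; have := none i; rewrite /P /is_part.
  have [oi _|ei] := boolP (odd i).
    rewrite (eqP (forallP large i)) /is_largest_even_part oi andbF //=.
  by rewrite andbT lt0n => /negbFE.
have m0 : (m ord0 = 0 :> nat)%N by apply/eqP; have := mL ord0.
have part_ev i : is_part m i -> ~~ odd i -> (i <= L)%N.
  move=> mi ei; have := mL i; rewrite /EObar_mult (negbTE ei) addbF.
  case: eqP => [-> //|_]; case: eqP => [-> //|_].
  by case: ltnP => [/ltnW //|_]; rewrite -leqn0 leqNgt; rewrite /is_part in mi; rewrite mi.
have part_odd i : is_part m i -> odd i -> (L < i)%N.
  move=> mi oi; have := mL i; rewrite /EObar_mult oi addbT.
  case: eqP => [i0|_]; first by rewrite i0 in oi.
  case: eqP => [iL|/eqP i_neqL]; first by rewrite iL (negbTE eL) in oi.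
  case: ltnP => [_|le_Li _]; last by rewrite ltn_neqAle eq_sym i_neqL.
  by rewrite /= -leqn0 leqNgt; rewrite /is_part in mi; rewrite mi.
split; first exact/eqP.
  apply/forallP => i; apply/forallP => j; apply/implyP => /and4P[mi ei mj oj].
  exact: leq_ltn_trans (part_ev i mi ei) (part_odd j mj oj).
apply/forallP => i; apply/eqP.
have := mL i; rewrite /EObar_mult /is_largest_even_part.
case: eqP => [i0 /eqP mi0|i_neq0]; first by rewrite /is_part mi0.
case: eqP => [iL omi|i_neqL].
  have -> : is_part m i by rewrite /is_part; case: (m i : nat) omi.
  rewrite omi iL eL /=; apply/esym/forallP => j; apply/implyP => /andP[mj ej].
  exact: part_ev.
case: ifP => cond.
  move=> emi; rewrite (negbTE emi); apply/esym/negbTE/negP => /and3P[mi ei maxi].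
  rewrite (negbTE ei) addbF in cond.
  have := mL L; rewrite /EObar_mult eqxx; case: eqP => [L0|_ oL].
    by rewrite L0 in cond.
  have := forallP maxi L; rewrite eL /is_part; case: (m L : nat) oL => //= _ _.
  by rewrite leqNgt cond.
by move=> /eqP mi0; rewrite /is_part mi0.
Qed.

Lemma in_EObar_partitions n (m : {ffun 'I_n.+1 -> 'I_n.+1}) :
  (m \in EObar_partitions n) =
  [exists L : 'I_n.+1, ~~ odd L && [forall i : 'I_n.+1, EObar_mult L i (m i)]]
  && ((\sum_(i < n.+1) i * m i)%N == n).
Proof.
have -> : [exists L : 'I_n.+1, ~~ odd L && [forall i : 'I_n.+1, EObar_mult L i (m i)]]
    = [&& (m ord0 == 0 :> nat)%N, even_lt_odd m &
        [forall i : 'I_n.+1, odd (m i) == is_largest_even_part m i]].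
  apply/idP/EObar_partitionsP => [/existsP[L /andP[eL /forallP mL]]|[L eL mL]].
    by exists L.
  by apply/existsP; exists L; rewrite eL; apply/forallP.
rewrite !inE /is_partition.
by case: even_lt_odd; case: [forall _, _]; rewrite ?andbT ?andbF.
Qed.

(** By distributivity a product of sums over the multiplicities is a sum over
    all functions with allowed values. *)
Lemma EObar_coef n :
  (EObar n)%:R = (\sum_(L < n.+1 | ~~ odd L) \prod_(i < n.+1)
                    \sum_(j < n.+1 | EObar_mult L i j) 'X^(i * j))`_n :> int.
Proof.
rewrite coef_sum.
transitivity (\sum_(L < n.+1 | ~~ odd L) \sum_(m : {ffun 'I_n.+1 -> 'I_n.+1})
   (if [forall i : 'I_n.+1, EObar_mult L i (m i)]
    then ((\sum_(i < n.+1) i * m i)%N == n)%:R else 0 : int)).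
  rewrite exchange_big /= /EObar -sum1_card natr_sum big_mkcond /=.
  apply: eq_bigr => m _; rewrite in_EObar_partitions.
  case: existsP => [[L /andP[eL mL]]|noL] /=.
    rewrite (bigD1 L eL) /= mL [X in _ + X]big1 ?addr0; first by case: eqP.
    move=> L' /andP[eL' neqL]; case: ifP => // mL'; case/eqP: neqL.
    exact: (EObar_mult_unique eL' eL (forallP mL') (forallP mL)).
  rewrite big1 // => L eL; case: ifP => // mL; case: noL.
  by exists L; rewrite eL.
apply: eq_bigr => L _; rewrite bigA_distr_big_dep coef_sum big_mkcond [RHS]big_mkcond /=.
apply: eq_bigr => m _; have -> : (m \in family (fun i j : 'I_n.+1 => EObar_mult L i j))
   = [forall i : 'I_n.+1, EObar_mult L i (m i)] by [].
case: ifP => // _; rewrite (_ : \prod_i _ = 'X^(\sum_(i < n.+1) i * m i)).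
  by rewrite coefXn eq_sym.
by rewrite prodrXr.
Qed.

Section GeneratingFunction.
Variable A : comNzRingType.

Lemma nil_sum (N M : nat) (P : pred nat) (F : nat -> A) :
  (forall i, (N <= i)%N -> F i = 0) -> (N <= M)%N ->
  \sum_(i < M | P i) F i = \sum_(i < N | P i) F i.
Proof.
move=> F0 le_NM; rewrite big_mkcond [RHS]big_mkcond /= -(subnKC le_NM).
rewrite big_split_ord /= [X in _ + X]big1 ?addr0 // => i _.
by case: ifP => // _; rewrite F0 // leq_addr.
Qed.

Lemma sum_even (M : nat) (F : nat -> A) :
  \sum_(i < M.*2 | ~~ odd i) F i = \sum_(k < M) F k.*2.
Proof.
rewrite big_mkcond /=; elim: M => [|M IH]; first by rewrite !big_ord0.
by rewrite doubleS !big_ord_recr /= IH odd_double addr0.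
Qed.

Lemma sum_odd (M : nat) (F : nat -> A) :
  \sum_(i < M.*2 | odd i) F i = \sum_(k < M) F k.*2.+1.
Proof.
rewrite big_mkcond /=; elim: M => [|M IH]; first by rewrite !big_ord0.
by rewrite doubleS !big_ord_recr /= IH odd_double addr0.
Qed.

Variables (q : A) (N : nat).
Hypothesis q_nil : q ^+ N = 0.

(** The truncated geometric series for 1 / (1 - q^(2 i)). *)
Let inv2 (i : nat) : A := \sum_(k < N) (q ^+ i.*2) ^+ k.

Lemma inv2K i : (0 < i)%N -> (1 - q ^+ i.*2) * inv2 i = 1.
Proof.
by move=> i_gt0; apply: geom_inv; apply: nil_expr; rewrite ?double_gt0.
Qed.

Lemma sum_even_mult i : (0 < i)%N ->
  \sum_(j < N | ~~ odd j) q ^+ (i * j) = inv2 i.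
Proof.
move=> i_gt0.
rewrite -(@nil_sum N N.*2 (fun j => ~~ odd j) (fun j => q ^+ (i * j))); last 2 first.
- by move=> j le_j; rewrite (nil_expr_ge q_nil) // (leq_trans le_j) ?leq_pmull.
- by rewrite -addnn leq_addr.
rewrite (sum_even N (fun j => q ^+ (i * j))); apply: eq_bigr => k _.
by rewrite -exprM; congr (_ ^+ _); lia.
Qed.

Lemma sum_odd_mult i : (0 < i)%N ->
  \sum_(j < N | odd j) q ^+ (i * j) = q ^+ i * inv2 i.
Proof.
move=> i_gt0; rewrite -(@nil_sum N N.*2 odd (fun j => q ^+ (i * j))); last 2 first.
- by move=> j le_j; rewrite (nil_expr_ge q_nil) // (leq_trans le_j) ?leq_pmull.
- by rewrite -addnn leq_addr.
rewrite (sum_odd N (fun j => q ^+ (i * j))) mulr_sumr.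
apply: eq_bigr => k _; rewrite -exprM -exprD.
by congr (_ ^+ _); lia.
Qed.

(** (Q; Q^2)_k / (Q^2; Q^2)_k for Q = q^2. *)
Let r (k : nat) : A :=
  \prod_(i < k) ((1 - q ^+ (i.*2.+1).*2) * inv2 i.+1.*2).

(** Multiplying by the odd product cancels the odd parts above 2 L and leaves
    the finite product over the odd exponents below 2 L, as in the terms of the
    q-binomial series with base Q^2 and a = z = Q, where Q = q^2. *)
Lemma EObar_mult_genfun L : (L.*2 < N)%N ->
  (\prod_(i < N) \sum_(j < N | EObar_mult L.*2 i j) q ^+ (i * j))
  * qodd (q ^+ 2) N = q ^+ L.*2 * r L.
Proof.
move=> lt_LN.
pose g i := if i == 0%N then 1 else if (i <= L.*2)%N then
  (if odd i then 1 - q ^+ i.*2 else (if i == L.*2 then q ^+ i else 1) * inv2 i) else 1.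
transitivity (\prod_(i < N) g i).
  have -> : qodd (q ^+ 2) N = \prod_(i < N) (if odd i then 1 - q ^+ i.*2 else 1).
    rewrite -(@nil_prod A N (fun i => if odd i then 1 - q ^+ i.*2 else 1) N.*2).
    - elim: (N) => [|n IH]; first by rewrite /qodd !big_ord0.
      rewrite /qodd doubleS !big_ord_recr /= -/(qodd _ _) IH odd_double /= mulr1.
      by rewrite -exprM; congr (_ * (1 - _ ^+ _)); lia.
    - by move=> i le_i; case: ifP => // _; rewrite (nil_expr_ge q_nil) ?subr0 //; lia.
    - by lia.
  rewrite -big_split /=; apply: eq_bigr => -[i lt_iN] _ /=; rewrite /g /EObar_mult.
  case: eqP => [->|/eqP i_neq0] /=.
    case: N lt_iN => // N' _; rewrite big_mkcond big_ord_recl /=.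
    by rewrite big1 ?addr0 ?expr0 ?mulr1.
  have i_gt0 : (0 < i)%N by lia.
  have sum0 : \sum_(j < N | j == 0%N :> nat) q ^+ (i * j) = 1.
    case: N lt_iN => // N' _; rewrite big_mkcond big_ord_recl /= big1 ?addr0 //.
    by rewrite muln0 expr0.
  case: eqP => [iL|/eqP i_neqL].
    by rewrite iL leqnn odd_double sum_odd_mult ?mulr1 // -?iL //; lia.
  rewrite (leq_eqVlt i) (negbTE i_neqL) /=.
  case: ltnP => [lt_iL|le_Li] /=; case: ifP => oi /=;
    rewrite ?sum0 ?sum_even_mult ?mul1r ?mulr1 //.
  by rewrite mulrC inv2K.
rewrite -[N](subnKC lt_LN) big_split_ord /= [X in _ * X]big1 ?mulr1; last first.
  by move=> i _; rewrite /g addSn /= ltnNge leq_addr.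
rewrite big_ord_recl /= mul1r.
have head M : (M < L)%N -> \prod_(i < M.*2) g (bump 0 i) = r M.
  elim: M => [|M IH] lt_ML; first by rewrite /r !big_ord0.
  rewrite doubleS !big_ord_recr /= IH; last by lia.
  rewrite /r big_ord_recr /= -mulrA; congr (_ * _).
  rewrite /g /bump !add1n /= odd_double /=.
  have -> : (M.*2 < L.*2)%N by lia.
  have -> : (M.*2.+1 < L.*2)%N by lia.
  have -> : (M.*2.+2 == L.*2) = false by lia.
  by rewrite mul1r doubleS.
case: L lt_LN @g head => [|L] lt_LN g head.
  by rewrite big_ord0 /r big_ord0 mulr1.
rewrite doubleS !big_ord_recr /= head // /r big_ord_recr /= -/(r L).
rewrite /g /bump !add1n /= odd_double /= -doubleS eqxx leqnn ifT; last by lia.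
by ring.
Qed.

(** The series in Q = q^2 is f_2 / (Q; Q^2)^2, and phi(-Q) = (Q; Q^2)^2 f_2, so
    the product of the two is f_2^2 = f_4 phi(-Q^2). *)
Lemma EObar_genfun K : (N <= K)%N ->
  (\sum_(L < N | ~~ odd L) \prod_(i < N) \sum_(j < N | EObar_mult L i j) q ^+ (i * j))
  * (1 + 2 * theta (q ^+ 2) K)
  = qpoch (q ^+ 8) N * (1 + 2 * theta (q ^+ 4) K).
Proof.
move=> le_NK; set E := \sum_(L < N | _) _.
have Q_nil k : (0 < k)%N -> (q ^+ k) ^+ N = 0 by exact: nil_expr.
have EO : E * qodd (q ^+ 2) N = \sum_(k < N) r k * (q ^+ 2) ^+ k.
  pose F L := if (L < N)%N then q ^+ L * r L./2 else 0.
  transitivity (\sum_(L < N | ~~ odd L) F L).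
    rewrite mulr_suml; apply: eq_bigr => L eL.
    have eL2 : (L : nat) = L./2.*2 by rewrite even_halfK.
    by rewrite /F ltn_ord {1}eL2 EObar_mult_genfun -?eL2.
  rewrite -(@nil_sum N N.*2 (fun j => ~~ odd j) F); last 2 first.
  - by move=> i le_i; rewrite /F ltnNge le_i.
  - by lia.
  rewrite (sum_even N F); apply: eq_bigr => k _; rewrite /F doubleK mulrC.
  case: ltnP => le; first by rewrite -exprM mul2n.
  by rewrite -exprM mul2n (nil_expr_ge q_nil) // mulr0.
have EOO : E * qodd (q ^+ 2) N ^+ 2 = qpoch (q ^+ 4) N.
  have r0 : r 0%N = 1 by rewrite /r big_ord0.
  have rS k : r k.+1 * (1 - (q ^+ 4) ^+ k.+1) = r k * (1 - q ^+ 2 * (q ^+ 4) ^+ k).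
    rewrite /r big_ord_recr /= -/(r k) -!exprM -exprD.
    have -> : (4 * k.+1 = k.+1.*2.*2)%N by lia.
    have -> : (2 + 4 * k = k.*2.+1.*2)%N by lia.
    by rewrite -!mulrA [inv2 _ * _]mulrC inv2K ?mulr1 // double_gt0.
  have z_nil : (q ^+ 2) ^+ N.+1 = 0 by rewrite exprS Q_nil ?mulr0.
  have := q_binomial r0 rS (Q_nil 4%N isT) z_nil.
  rewrite big_ord_recr /= Q_nil // mulr0 addr0 -EO => E1.
  have qoddE : qodd (q ^+ 2) N = \prod_(j < N) (1 - q ^+ 2 * (q ^+ 4) ^+ j).
    by apply: eq_bigr => i _; rewrite -!exprM -exprD; congr (1 - _ ^+ _); lia.
  rewrite expr2 mulrCA {1}qoddE E1; apply: eq_bigr => i _.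
  by rewrite -exprD -exprS.
have Q2 := Q_nil 2%N isT; have Q4 := Q_nil 4%N isT.
rewrite -(gauss_theta Q2 le_NK) -(gauss_theta Q4 le_NK) -!exprM.
have H := qpoch_qodd Q4; rewrite -exprM in H.
by rewrite [LHS]mulrA EOO [(2 * 2)%N]/= H; ring.
Qed.
End GeneratingFunction.

(** * Reduction modulo 8 and modulo 2 *)

Section Morphisms.
Variables (A B : comNzRingType) (phi : {rmorphism A -> B}).

Lemma rmorph_qpoch q n : phi (qpoch q n) = qpoch (phi q) n.
Proof.
rewrite rmorph_prod; apply: eq_bigr => i _.
by rewrite rmorphB rmorph1 rmorphXn.
Qed.

Lemma rmorph_psi q K : phi (psi q K) = psi (phi q) K.
Proof. by rewrite rmorph_sum; apply: eq_bigr => i _; rewrite rmorphXn. Qed.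
End Morphisms.

Definition square_sum (A : pzRingType) (q : A) (K : nat) : A :=
  \sum_(k < K) q ^+ (k.+1 ^ 2).

Lemma rmorph_square_sum (A B : comNzRingType) (phi : {rmorphism A -> B}) q K :
  phi (square_sum q K) = square_sum (phi q) K.
Proof. by rewrite rmorph_sum; apply: eq_bigr => i _; rewrite rmorphXn. Qed.

(** An even square is 4 l^2 and an odd square is 1 + 8 T with T triangular. *)
Lemma theta_dissection (A : comNzRingType) (q : A) K :
  theta q K.*2 = square_sum (q ^+ 4) K - q * psi (q ^+ 8) K.
Proof.
elim: K => [|K IH]; first by rewrite /theta /square_sum /psi !big_ord0 mulr0 subr0.
rewrite /theta doubleS !big_ord_recr /= -/(theta _ _) IH.
rewrite /square_sum /psi [in RHS]big_ord_recr [X in _ = _ - _ * X]big_ord_recr /=.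
rewrite mulrDr -!exprM -exprS !(exprS (-1)).
have -> : (8 * 'C(K.+1, 2)).+1 = (K.*2.+1 ^ 2)%N by have := bin2_double K; nia.
have -> : (4 * (K.+1 ^ 2) = K.*2.+2 ^ 2)%N by nia.
by rewrite -mul2n exprM sqrrN expr1n expr1n; ring.
Qed.

(** With theta(q^2) = a - q^2 b and theta(q^4) = a' - q^4 b', where a, b, a', b'
    are series in q^8, the only product with an exponent 6 modulo 8 and a
    coefficient not divisible by 8 is (- 2 q^4 b') (2 q^2 b). *)
Lemma EObar_coef_mod8 n : exists J : int,
  (EObar (8 * n + 6))%:R = 8 * J -
    4 * (qpoch 'X (8 * n + 7) * psi ('X^2) (8 * n + 7) * psi ('X^4) (8 * n + 7))`_n.
Proof.
have [A [pi [q_nil pi_surj pi_inj]]] := @truncated_polynomials int (8 * n + 7) ltac:(lia).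
set N := (8 * n + 7)%N in q_nil pi_inj *; set q := pi 'X in q_nil.
have NE : ((8 * n + 6).+1 = N)%N by rewrite /N; lia.
have := @EObar_genfun A q N q_nil N.*2 ltac:(lia).
set E := \sum_(L < N | _) _ => genE; rewrite EObar_coef NE.
set PE := \sum_(L < N | _) _.
have piE : pi PE = E.
  rewrite rmorph_sum; apply: eq_bigr => L _; rewrite rmorph_prod.
  apply: eq_bigr => i _; rewrite rmorph_sum; apply: eq_bigr => j _.
  by rewrite rmorphXn.
pose phi (p : {poly int}) := pi (p \Po 'X^8).
pose a := square_sum ('X : {poly int}) N.
pose a' := square_sum ('X^2 : {poly int}) N.
pose b := psi ('X^2 : {poly int}) N.
pose b' := psi ('X^4 : {poly int}) N.
pose f := qpoch ('X : {poly int}) N.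
rewrite -/f -/b -/b'; rewrite !theta_dissection -!exprM in genE.
have phiX k : phi 'X^k = q ^+ (8 * k).
  by rewrite /phi comp_Xn_poly -exprM rmorphXn.
have fE : qpoch (q ^+ 8) N = phi f.
  by rewrite /phi !rmorph_qpoch /= comp_polyX rmorphXn.
have aE : square_sum (q ^+ (2 * 4)) N = phi a.
  by rewrite /phi !rmorph_square_sum /= comp_polyX rmorphXn.
have a'E : square_sum (q ^+ (4 * 4)) N = phi a'.
  by rewrite /phi !rmorph_square_sum /= -/(phi _) phiX.
have bE : psi (q ^+ (2 * 8)) N = phi b.
  by rewrite /phi !rmorph_psi /= -/(phi _) phiX.
have b'E : psi (q ^+ (4 * 8)) N = phi b'.
  by rewrite /phi !rmorph_psi /= -/(phi _) phiX.
rewrite fE aE a'E bE b'E in genE.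
(* s0, s1, s2 collect the exponents 0, 2 and 4 modulo 8. *)
pose s0 := f * (1 + 2 * a') * (1 - 2 * a + 4 * a ^+ 2).
pose s1 := f * (1 + 2 * a') * (2 * b - 8 * (a * b)).
pose s2 := f * ((1 + 2 * a') * (4 * b ^+ 2) - 2 * b' * (1 - 2 * a + 4 * a ^+ 2)).
pose t := phi a - q ^+ 2 * phi b.
have [Jp JpE] := pi_surj (phi f * (2 * q ^+ 6 * phi a * phi b * phi b'
   - q ^+ 8 * phi b' * phi b ^+ 2) - t ^+ 3 * E).
have key : pi PE = pi ((s0 \Po 'X^8) + 'X^2 * (s1 \Po 'X^8) + 'X^4 * (s2 \Po 'X^8)
   + 8 * Jp - 4 * ('X^6 * ((f * b * b') \Po 'X^8))).
  rewrite !(rmorphD pi, rmorphB pi, rmorphM pi, rmorph_nat pi, rmorphXn pi) JpE -/q.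
  rewrite -!/(phi _).
  have phiM x y : phi (x * y) = phi x * phi y by rewrite /phi !rmorphM.
  have phiD x y : phi (x + y) = phi x + phi y by rewrite /phi !rmorphD.
  have phiN x : phi (- x) = - phi x by rewrite /phi !rmorphN.
  have phin k : phi k%:R = k%:R by rewrite /phi !rmorph_nat.
  have phi1 : phi 1 = 1 by rewrite /phi !rmorph1.
  rewrite /s0 /s1 /s2 !expr2 !(phiM, phiD, phiN, phin, phi1) piE.
  rewrite -/t in genE.
  (* 1 + 8 t^3 = (1 + 2 t) (1 - 2 t + 4 t^2) inverts 1 + 2 t modulo 8. *)
  have e : E = E * (1 + 2 * t) * (1 - 2 * t + 4 * t ^+ 2) - 8 * (t ^+ 3 * E) by ring.
  rewrite {1}e genE /t; ring.
exists Jp`_(8 * n + 6).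
rewrite (pi_inj _ _ key) ?(coefD, coefB) //; last by rewrite /N; lia.
rewrite !coefXnM !coef_comp_poly_Xn //.
have -> : (8 %| 8 * n + 6)%N = false by lia.
have -> : (8 %| 8 * n + 6 - 2)%N = false by lia.
have -> : (8 %| 8 * n + 6 - 4)%N = false by lia.
rewrite !if_same !add0r coefN !mulr_natl !coefMn coefXnM.
rewrite coef_comp_poly_Xn // addnK dvdn_mulr // mulKn // ifF //; lia.
Qed.

(** psi = f_1 f_2 turns f_1 psi(q^2) psi(q^4) into f_1 f_2 f_4^2 f_8, and
    f_4^2 = f_8, f_8^2 = f_16 leave psi(q) f_16. *)
Lemma coef_psi_qfact_pchar2 (R : comNzRingType) N n : 2 \in [pchar R] -> (n < N)%N ->
  (qpoch 'X N * psi ('X^2) N * psi ('X^4) N : {poly R})`_n =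
  (psi 'X N * (1 + \sum_(k < N) (-1) ^+ k.+1 *
    ('X^(16 * (k.+1 + 3 * 'C(k.+1, 2))) + 'X^(16 * (2 * k.+1 + 3 * 'C(k.+1, 2))))))`_n.
Proof.
move=> ch2 lt_nN; have N_gt0 : (0 < N)%N by lia.
have [A [pi [q_nil _ pi_inj]]] := @truncated_polynomials R N N_gt0.
apply: pi_inj lt_nN; set q := pi 'X in q_nil.
have chA : 2 \in [pchar A].
  exact: (rmorph_pchar pi (rmorph_pchar polyC ch2)).
have nilk k : (0 < k)%N -> (q ^+ k) ^+ N = 0 by exact: nil_expr.
rewrite !rmorphM !rmorph_psi rmorph_qpoch rmorphD rmorph1 rmorph_sum !rmorphXn -/q.
transitivity (psi q N * qpoch (q ^+ 16) N).
  rewrite -(gauss_psi_pchar2 q_nil chA (leqnn N)).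
  rewrite -(gauss_psi_pchar2 (nilk 2%N isT) chA (leqnn N)).
  rewrite -(gauss_psi_pchar2 (nilk 4%N isT) chA (leqnn N)).
  have sqr k : qpoch ((q ^+ k) ^+ 2) N = qpoch (q ^+ k) N ^+ 2.
    exact: qpoch_sqr_pchar2.
  have -> : q ^+ 16 = (q ^+ 8) ^+ 2 by rewrite -exprM.
  have e8 : q ^+ 8 = (q ^+ 4) ^+ 2 by rewrite -exprM.
  have e4 : q ^+ 4 = (q ^+ 2) ^+ 2 by rewrite -exprM.
  by rewrite -e4 -e8 sqr e8 sqr; ring.
congr (_ * _); rewrite (euler_pentagonal (nilk 16%N isT) (leqnn N)).
congr (_ + _); apply: eq_bigr => k _.
by rewrite rmorphM rmorphD rmorphXn rmorphN1 !rmorphXn -!exprM.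
Qed.


(** A triangular number is (x^2 - 1) / 8 and a generalized pentagonal number is
    (y^2 - 1) / 24, so an exponent n of psi(q) f_16 satisfies
    24 n + 19 = 3 x^2 + 16 y^2. *)
Lemma not_dvd8_EObar n : (EObar (8 * n + 6) %% 8 != 0)%N ->
  exists a b : nat, (24 * n + 19 = 3 * a ^ 2 + 16 * b ^ 2)%N.
Proof.
move=> nz; pose rep m := exists a b : nat, (24 * m + 19 = 3 * a ^ 2 + 16 * b ^ 2)%N.
have [//|norep] := boolp.pselect (rep n).
have repP j e b : (24 * e + 1 = b ^ 2)%N -> n = ('C(j.+1, 2) + 16 * e)%N -> rep n.
  move=> eb ->; exists j.*2.+1, b; rewrite -eb.
  by have := bin2_double j; nia.
have pent k : exists b1 b2, (24 * (k.+1 + 3 * 'C(k.+1, 2)) + 1 = b1 ^ 2)%N /\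
    (24 * (2 * k.+1 + 3 * 'C(k.+1, 2)) + 1 = b2 ^ 2)%N.
  exists (6 * k + 5)%N, (6 * k + 7)%N.
  by have := bin2_double k; split; nia.
set N := (8 * n + 7)%N; pose F : {poly int} := qpoch 'X N * psi ('X^2) N * psi ('X^4) N.
suff : ~~ odd (absz F`_n).
  have [J] := EObar_coef_mod8 n; rewrite -/N -/F natz.
  move: F`_n => c EJ ec; case/negP: nz.
  have cE := even_halfK ec; move: (absz c)./2 cE => h cE.
  have [ch|ch] : (c = 2 * h%:Z \/ c = - 2 * h%:Z)%R by lia.
    by rewrite ch in EJ; lia.
  by rewrite ch in EJ; lia.
pose phi : {rmorphism int -> 'F_2} := intr.
have : phi F`_n = 0.
  rewrite -coef_map /F !rmorphM rmorph_qpoch !rmorph_psi /= !rmorphXn /= map_polyX.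
  rewrite coef_psi_qfact_pchar2 ?pchar_Fp //; last by rewrite /N; lia.
  rewrite /psi mulr_suml coef_sum big1 // => j _.
  rewrite coefXnM; case: ltnP => // le_jn.
  rewrite coefD coef1 coef_sum big1 ?addr0 => [|k _].
    case: eqP => // e0; case: norep; apply: (@repP j 0%N 1%N) => //; lia.
  have [b1 [b2 [E1 E2]]] := pent k.
  rewrite -signr_odd mulr_sign.
  have Xn e b : (24 * e + 1 = b ^ 2)%N ->
      ('X^(16 * e) : {poly 'F_2})`_(n - 'C(j.+1, 2)) = 0.
    move=> eb; rewrite coefXn; case: eqP => // en; case: norep.
    by apply: (@repP j e b eb); lia.
  by case: ifP => _; rewrite ?coefN coefD (Xn _ _ E1) (Xn _ _ E2) addr0 ?oppr0.
rewrite /=; move: F`_n => c c0.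
suff : (absz c)%:R = 0 :> 'F_2.
  by move/eqP; rewrite -(dvdn_pcharf (pchar_Fp (isT : prime 2))) dvdn2.
case: c c0 => k; first by [].
by rewrite NegzE mulrNz -pmulrn => /eqP; rewrite oppr_eq0 => /eqP.
Qed.

(** * Inert primes of the Eisenstein integers are plentiful *)

Section Inert.
Variable R : realFieldType.

(** The nontrivial Dirichlet character modulo 3. *)
Definition chi3 (n : nat) : R :=
  if (n %% 3 == 1)%N then 1 else if (n %% 3 == 2)%N then -1 else 0.

(** The completely multiplicative function that agrees with [chi3] at the primes
    outside ps and is 1 at the primes of ps. *)
Definition chi3_off (ps : seq nat) (n : nat) : R :=
  chi3 (partn n (negn [pred p in ps])).

Definition chi3_sum (ps : seq nat) (x : nat) : R :=
  \sum_(k < x) chi3_off ps k.+1 / k.+1%:R.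

Lemma chi3M m n : chi3 (m * n) = chi3 m * chi3 n.
Proof.
rewrite /chi3 -modnMm.
move: (m %% 3)%N (n %% 3)%N (ltn_pmod m (isT : 0 < 3)%N) (ltn_pmod n (isT : 0 < 3)%N).
by move=> [|[|[|]]] // [|[|[|]]] // _ _;
  rewrite /= ?mul0r ?mulr0 ?mul1r ?mulr1 ?mulrNN ?mulr1.
Qed.

(** The series 1 - 1/2 + 1/4 - 1/5 + ... is alternating with decreasing terms. *)
Lemma chi3_sum_nil x : chi3_sum [::] x <= 1.
Proof.
have offE n : (0 < n)%N -> chi3_off [::] n = chi3 n.
  by move=> n_gt0; rewrite /chi3_off (@eq_partn _ predT) ?partnT.
have SS n : chi3_sum [::] n.+1 = chi3_sum [::] n + chi3 n.+1 / n.+1%:R.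
  by rewrite /chi3_sum big_ord_recr /= offE.
have chi1 m : chi3 (3 * m).+1 = 1.
  by rewrite /chi3 ifT //; lia.
have chi2 m : chi3 (3 * m).+2 = -1.
  by rewrite /chi3 ifF ?ifT //; lia.
have chi0 m : chi3 (3 * m).+3 = 0.
  by rewrite /chi3 ifF ?ifF //; lia.
have inv_ge0 n : 0 <= n.+1%:R^-1 :> R by rewrite invr_ge0.
have S3 m : chi3_sum [::] (3 * m) <= 1 - (3 * m).+1%:R^-1.
  elim: m => [|m IH]; first by rewrite muln0 /chi3_sum big_ord0 invr1 subrr.
  have -> : (3 * m.+1 = (3 * m).+3)%N by lia.
  rewrite !SS chi1 chi2 chi0 mul1r mul0r mulN1r addr0.
  have : (3 * m).+4%:R^-1 <= (3 * m).+2%:R^-1 :> R.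
    by rewrite lef_pV2 ?posrE ?ltr0n // ler_nat; lia.
  move: IH; move: (chi3_sum _ _) (3 * m).+1%:R^-1 (3 * m).+2%:R^-1 (3 * m).+4%:R^-1.
  by move=> S a b c; lra.
rewrite (divn_eq x 3) mulnC; have := S3 (x %/ 3)%N; have := ltn_pmod x (isT : 0 < 3)%N.
have := inv_ge0 (3 * (x %/ 3))%N; have := inv_ge0 (3 * (x %/ 3)).+1.
case: (x %% 3)%N => [|[|[|]]] //; rewrite ?addn0 ?addn1 ?addn2 ?SS ?chi1 ?chi2.
all: move: (chi3_sum _ _) (3 * (x %/ 3)).+1%:R^-1 (3 * (x %/ 3)).+2%:R^-1.
all: by move=> S a b; lra.
Qed.

Lemma sum_split_multiples p x (g : nat -> R) : (0 < p)%N ->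
  \sum_(k < x) g k.+1 =
  \sum_(k < x | ~~ (p %| k.+1)%N) g k.+1 + \sum_(k < x %/ p) g (p * k.+1)%N.
Proof.
move=> p_gt0; elim: x => [|x IH]; first by rewrite div0n !big_ord0 addr0.
rewrite big_ord_recr /= IH [X in _ = X + _]big_mkcond big_ord_recr -big_mkcond /=.
rewrite divnS //; case: ifPn => [ndvd|/negPn dvd].
  by rewrite (negbTE ndvd) add0n; ring.
rewrite dvd add1n big_ord_recr /= addr0 -addrA.
have -> : (p * (x %/ p).+1 = x.+1)%N.
  by rewrite -[(x %/ p).+1]add1n -[1%N]/(true : nat) -dvd -divnS // mulnC divnK.
by [].
Qed.

Lemma chi3_off_cons_dvd p ps n : prime p -> (0 < n)%N ->
  chi3_off (p :: ps) (p * n) = chi3_off (p :: ps) n.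
Proof.
move=> p_pr n_gt0; rewrite /chi3_off partnM ?(prime_gt0 p_pr) //.
have -> : partn p (negn [pred r in p :: ps]) = 1%N.
  by rewrite part_p'nat // pnatNK pnatE // !inE eqxx.
by rewrite mul1n.
Qed.

Lemma chi3_off_cons_ndvd p ps n : prime p -> (0 < n)%N -> ~~ (p %| n)%N ->
  chi3_off (p :: ps) n = chi3_off ps n.
Proof.
move=> p_pr n_gt0 ndvd; congr chi3; apply: eq_in_partn => r.
rewrite mem_primes => /and3P[_ _ rn]; rewrite !inE negb_or.
by have -> : r != p by apply: contraNneq ndvd => <-.
Qed.

Lemma chi3_off_mul p ps n : prime p -> p \notin ps -> (0 < n)%N ->
  chi3_off ps (p * n) = chi3 p * chi3_off ps n.
Proof.
move=> p_pr pNps n_gt0; rewrite /chi3_off partnM ?(prime_gt0 p_pr) // chi3M.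
have -> : partn p (negn [pred r in ps]) = p.
  by rewrite part_pnat_id // pnatE // !inE.
by [].
Qed.

(** The terms prime to p are the same for ps and for p :: ps; in both sums the
    multiples of p form a scaled copy of the sum up to x / p. *)
Lemma chi3_sum_cons p ps x : prime p -> p \notin ps ->
  chi3_sum (p :: ps) x = chi3_sum ps x - chi3 p * p%:R^-1 * chi3_sum ps (x %/ p)
    + p%:R^-1 * chi3_sum (p :: ps) (x %/ p).
Proof.
move=> p_pr pNps; have p_gt0 := prime_gt0 p_pr.
rewrite /chi3_sum !(@sum_split_multiples p x (fun k => _ k / k%:R)) //.
rewrite !mulr_sumr -!addrA; congr (_ + _).
  by apply: eq_bigr => k ndvd; rewrite chi3_off_cons_ndvd.
rewrite addrA -sumrB [X in _ = X + _]big1 ?add0r => [|k _].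
  apply: eq_bigr => k _; rewrite chi3_off_cons_dvd // natrM invfM; ring.
by rewrite chi3_off_mul // natrM invfM; ring.
Qed.

(** By induction on x, a bound M for ps yields a bound M' for p :: ps as soon as
    M + M / p + M' / p = M'. *)
Lemma chi3_sum_le ps x :
  uniq ps -> all prime ps -> all (fun p => p %% 3 != 1)%N ps ->
  chi3_sum ps x <= \prod_(p <- ps) ((1 + p%:R^-1) / (1 - p%:R^-1)).
Proof.
elim: ps x => [|p ps IH] x /=; first by rewrite big_nil => _ _ _; exact: chi3_sum_nil.
move=> /andP[pNps uniq_ps] /andP[p_pr ps_pr] /andP[p_ns ps_ns].
have {}IH y := IH y uniq_ps ps_pr ps_ns; rewrite big_cons.
set M := \prod_(_ <- _) _ in IH *.
have M_ge0 : 0 <= M.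
  by have := IH 0%N; rewrite /chi3_sum big_ord0.
have p_gt1 : 1 < p%:R :> R by rewrite ltr1n prime_gt1.
set u := p%:R^-1; have u_gt0 : 0 < u by rewrite invr_gt0; lra.
have u_lt1 : u < 1 by rewrite invf_lt1 //; lra.
set M' := (1 + u) / (1 - u) * M.
have M'E : M + u * M + u * M' = M' by rewrite /M'; field; lra.
have M'_ge0 : 0 <= M' by rewrite !mulr_ge0 ?invr_ge0 //; lra.
have [n] := ubnP x; elim: n => // n IHn in x * => lt_xn.
have [->|x_gt0] := posnP x; first by rewrite /chi3_sum big_ord0.
rewrite chi3_sum_cons // -M'E -/u.
have lt_px : (x %/ p < n)%N.
  by apply: leq_trans (ltn_Pdiv (prime_gt1 p_pr) x_gt0) _.
have h1 : u * chi3_sum (p :: ps) (x %/ p) <= u * M'.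
  by rewrite ler_pM2l // IHn.
have h2 := IH x.
have h3 : u * chi3_sum ps (x %/ p) <= u * M by rewrite ler_pM2l // IH.
have uM : 0 <= u * M by rewrite mulr_ge0 // ltW.
rewrite -mulrA /chi3 (negbTE p_ns); case: ifP => _; lra.
Qed.

Lemma chi3_1 m : (0 < m)%N -> (forall p, prime p -> (p %| m)%N -> (p %% 3 = 1)%N) ->
  (m %% 3 = 1)%N.
Proof.
have [n] := ubnP m; elim: n => // n IH in m * => lt_mn m_gt0 all1.
have [->|m_neq1] := eqVneq m 1%N; first by [].
have m_gt1 : (1 < m)%N by lia.
have p_pr := pdiv_prime m_gt1; have p_dvd := pdiv_dvd m.
rewrite -(divnK p_dvd) -modnMm (all1 _ p_pr p_dvd) muln1 modn_mod.
apply: IH.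
- by apply: leq_trans (ltn_Pdiv (prime_gt1 p_pr) m_gt0) _.
- by rewrite divn_gt0 ?prime_gt0 // dvdn_leq.
by move=> q q_pr q_dvd; apply: all1 => //; rewrite -(divnK p_dvd) dvdn_mulr.
Qed.

(** An integer whose prime factors are all 1 modulo 3 is 1 modulo 3. *)
Lemma chi3_sum_harmonic ps x :
  (forall p, prime p -> (p <= x)%N -> (p %% 3 != 1)%N -> p \in ps) ->
  chi3_sum ps x = \sum_(k < x) k.+1%:R^-1.
Proof.
move=> psP; apply: eq_bigr => k _; rewrite -[RHS]mul1r; congr (_ * _).
rewrite /chi3_off /chi3 chi3_1 // => p p_pr p_dvd.
have : (p \in \pi(partn k.+1 (negn [pred p in ps])))%N by rewrite mem_primes p_pr part_gt0.
rewrite pi_of_part // !inE => /andP[]; rewrite mem_primes => /and3P[_ _ p_dvdk].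
apply: contraNeq => p_ns; apply: psP => //.
by apply: leq_trans (dvdn_leq _ p_dvdk) _.
Qed.
End Inert.

(** * Sieving by the inert primes *)

Section Sieve.
Local Open Scope nat_scope.

(** Cubing is injective modulo p, since 3 does not divide p - 1: Fermat's theorem
    x = x^p = (x^3)^(p / 3) x^2 recovers x from x^3. *)
Lemma Fp_cube_inj p (s t : 'F_p) : prime p -> p %% 3 = 2 ->
  (s ^+ 3 = t ^+ 3 -> s = t)%R.
Proof.
move=> p_pr p_mod3 st.
have fermat (x : 'F_p) : (x = (x ^+ 3) ^+ (p %/ 3) * x ^+ 2)%R.
  rewrite -exprM -exprD; have -> : 3 * (p %/ 3) + 2 = p by lia.
  by rewrite -{1}[x]expf_card card_Fp.
have [s0|s_neq0] := eqVneq s 0%R.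
  move: st; rewrite s0 expr0n /= => /esym/eqP; rewrite expf_eq0 => /andP[_ /eqP ->] //.
have t_neq0 : t != 0%R.
  by apply: contraNneq s_neq0 => t0; move/eqP: st; rewrite t0 expr0n expf_eq0.
have := fermat s; have := fermat t; rewrite st.
set c := (t ^+ 3 ^+ _)%R => Et Es.
have ct : (c * t = 1)%R by apply: (mulIf t_neq0); rewrite mul1r -mulrA -expr2 -Et.
have cs : (c * s = 1)%R by apply: (mulIf s_neq0); rewrite mul1r -mulrA -expr2 -Es.
by rewrite -[s]mulr1 -ct mulrCA mulrA cs mul1r.
Qed.

(** -3 is not a square modulo p.  Indeed X^2 = -3 y^2 gives
    (X - y)^3 = (2 y)^3, hence X = 3 y by [Fp_cube_inj], and then 12 y^2 = 0. *)
Lemma inert_dvd_form p a b : prime p -> 5 <= p -> p %% 3 = 2 ->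
  p %| 3 * a ^ 2 + 16 * b ^ 2 -> p ^ 2 %| 3 * a ^ 2 + 16 * b ^ 2.
Proof.
move=> p_pr p_ge5 p_mod3 p_dvd.
have ndvd m : 0 < m < 5 -> ~~ (p %| m).
  by move=> /andP[m_gt0 m_lt5]; apply/negP => /(dvdn_leq m_gt0); lia.
have Fp0 m : (m%:R == 0 :> 'F_p)%R = (p %| m) by rewrite (dvdn_pcharf (pchar_Fp p_pr)).
pose X : 'F_p := (3 * a)%:R%R; pose y : 'F_p := (4 * b)%:R%R.
have XY : (X ^+ 2 = - 3 * y ^+ 2)%R.
  apply/eqP; rewrite mulNr -subr_eq0 opprK -!natrX -natrM -natrD Fp0.
  have -> : (3 * a) ^ 2 + 3 * (4 * b) ^ 2 = 3 * (3 * a ^ 2 + 16 * b ^ 2) by lia.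
  by rewrite dvdn_mull.
have cube : ((X - y) ^+ 3 = (2 * y) ^+ 3)%R.
  transitivity (X * X ^+ 2 - 3 * X ^+ 2 * y + 3 * X * y ^+ 2 - y ^+ 3)%R; first by ring.
  by rewrite XY; ring.
have X3y : (X = 3 * y)%R.
  have /eqP := Fp_cube_inj p_pr p_mod3 cube; rewrite subr_eq => /eqP ->; ring.
have y0 : (12 * y ^+ 2 = 0)%R.
  have -> : (12 * y ^+ 2 = (3 * y) ^+ 2 - (- 3 * y ^+ 2))%R by ring.
  by rewrite -X3y XY subrr.
have p_b : p %| b.
  move/eqP: y0; rewrite /y -natrX -natrM Fp0.
  have -> : 12 * (4 * b) ^ 2 = 3 * (4 * (4 * 4)) * b ^ 2 by lia.
  rewrite Euclid_dvdM // [p %| 3 * _]Euclid_dvdM // [p %| 4 * _]Euclid_dvdM //.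
  rewrite [p %| 4 * _]Euclid_dvdM // (negbTE (ndvd 3 isT)) (negbTE (ndvd 4 isT)) /=.
  by rewrite Euclid_dvdX // andbT.
have p_a : p %| a.
  move: p_dvd; rewrite dvdn_addl; last by rewrite dvdn_mull // expnS dvdn_mulr.
  by rewrite Euclid_dvdM // (negbTE (ndvd 3 isT)) Euclid_dvdX //= andbT.
by rewrite dvdn_add // dvdn_mull // dvdn_exp2r.
Qed.

Lemma sum_blocks a b (F : nat -> nat) :
  \sum_(n < a * b) F n = \sum_(i < a) \sum_(j < b) F (b * i + j).
Proof.
elim: a => [|a IH]; first by rewrite mul0n !big_ord0.
rewrite mulSn addnC big_split_ord /= IH big_ord_recr /=; congr (_ + _).
by apply: eq_bigr => j _; rewrite mulnC.
Qed.

(** An affine map with slope prime to a permutes the residues modulo a. *)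
Lemma sum_affine a b j (f : nat -> nat) : coprime b a -> (forall n, f (n %% a) = f n) ->
  \sum_(i < a) f (b * i + j) = \sum_(i < a) f i.
Proof.
case: a => [|a] co f_per; first by rewrite !big_ord0.
pose h (i : 'I_a.+1) : 'I_a.+1 := Ordinal (ltn_pmod (b * i + j) (ltn0Sn a)).
have h_inj : injective h.
  move=> i i' /(congr1 val) /= /eqP; rewrite eqn_modDr => /eqP E.
  apply/val_inj => /=.
  wlog le_ii' : i i' E / i <= i' => [W|].
    by case: (leqP i i') => [|/ltnW] le; [exact: W | apply/esym/W].
  have : a.+1 %| b * (i' - i).
    by rewrite mulnBr -eqn_mod_dvd ?leq_mul2l ?le_ii' ?orbT // E.
  rewrite Gauss_dvdr; last by rewrite coprime_sym.
  have [e _|pos] := posnP (i' - i); first by apply/eqP; rewrite eqn_leq le_ii' -subn_eq0 e.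
  by move/(dvdn_leq pos); have := ltn_ord i'; lia.
by rewrite [RHS](reindex_inj h_inj) /=; apply: eq_bigr => i _; rewrite f_per.
Qed.

(** The Chinese remainder theorem as independence: conditions modulo coprime
    integers have multiplicative counts. *)
Lemma sum_crt a b (f g : nat -> nat) : coprime a b ->
  (forall n, f (n %% a) = f n) -> (forall n, g (n %% b) = g n) ->
  \sum_(n < a * b) f n * g n = (\sum_(n < a) f n) * (\sum_(n < b) g n).
Proof.
move=> co f_per g_per; rewrite (@sum_blocks a b (fun n => f n * g n)).
rewrite exchange_big /= big_distrr /=.
apply: eq_bigr => j _; rewrite -(@sum_affine a b j f) 1?coprime_sym // big_distrl /=.
apply: eq_bigr => i _; congr (_ * _).
by rewrite -(g_per (b * i + j)) [b * i]mulnC modnMDl g_per.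
Qed.

Definition exactly_divides (p n : nat) : bool := (p %| n) && ~~ (p ^ 2 %| n).

Lemma sum_not_exactly_divides p : 0 < p ->
  \sum_(n < p ^ 2) ~~ exactly_divides p n = p ^ 2 - p + 1.
Proof.
move=> p_gt0; rewrite -[in LHS]mulnn (@sum_blocks p p (fun n => ~~ exactly_divides p n)).
transitivity (\sum_(i < p) (p.-1 + (i == 0 :> nat))).
  apply: eq_bigr => i _; case: p p_gt0 i => // p _ i.
  rewrite big_ord_recl /= addn0 addnC; congr (_ + _).
    rewrite -[RHS](card_ord p) -sum1_card; apply: eq_bigr => j _.
    rewrite /exactly_divides dvdn_addr ?dvdn_mulr // gtnNdvd //=.
    by rewrite /bump add1n ltnS.
  rewrite /exactly_divides dvdn_mulr // expnS expn1 dvdn_pmul2l //= negbK.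
  have [->|i_gt0] := posnP i; first by rewrite dvdn0.
  by rewrite gtnNdvd // ; lia.
rewrite big_split /= sum_nat_const card_ord.
have -> : \sum_(i < p) (i == 0 :> nat) = 1.
  by case: p p_gt0 => // p _; rewrite big_ord_recl big1.
by rewrite -mulnn; nia.
Qed.

Lemma exactly_divides_mod p d c e n : p ^ 2 %| d ->
  exactly_divides p (c * (n %% d) + e) = exactly_divides p (c * n + e).
Proof.
move=> pd; rewrite /exactly_divides.
have E r : r %| p ^ 2 -> (r %| c * (n %% d) + e) = (r %| c * n + e).
  move=> rp; have rd := dvdn_trans rp pd.
  by rewrite {2}(divn_eq n d) mulnDr -addnA [RHS]dvdn_addr // mulnA dvdn_mull.
by rewrite !E // expnS dvdn_mulr.
Qed.

(** The density of the n such that no p in ps divides 24 n + 19 exactly once,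
    written as a count over one period. *)
Lemma sieve_count ps : uniq ps -> all prime ps -> all (leq 5) ps ->
  \sum_(n < \prod_(p <- ps) p ^ 2) all (fun p => ~~ exactly_divides p (24 * n + 19)) ps
  = \prod_(p <- ps) (p ^ 2 - p + 1).
Proof.
pose good p n := ~~ exactly_divides p (24 * n + 19).
have good_per p d n : p ^ 2 %| d -> good p (n %% d) = good p n.
  by move=> pd; rewrite /good exactly_divides_mod.
elim: ps => [|p ps IH] /=; first by rewrite !big_nil big_ord1.
move=> /andP[pNps uniq_ps] /andP[p_pr ps_pr] /andP[p_ge5 ps_ge5].
rewrite !big_cons -IH //.
transitivity (\sum_(n < p ^ 2 * \prod_(q <- ps) q ^ 2) good p n * all (good^~ n) ps).
  by apply: eq_bigr => n _; rewrite mulnb.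
have co : coprime (p ^ 2) (\prod_(q <- ps) q ^ 2).
  rewrite coprimeXl //; elim: ps pNps ps_pr {uniq_ps ps_ge5 IH} => [|q ps IH] /=.
    by rewrite big_nil coprimen1.
  rewrite inE negb_or => /andP[pq pNps] /andP[q_pr ps_pr].
  rewrite big_cons coprimeMr coprimeXr ?IH //.
  by rewrite prime_coprime // dvdn_prime2.
rewrite (sum_crt (f := fun n => good p n) (g := fun n => all (good^~ n) ps)) //.
- congr (_ * _).
  rewrite -(sum_not_exactly_divides (prime_gt0 p_pr)).
  apply: (@sum_affine _ 24 19 (fun n => ~~ exactly_divides p n)).
    rewrite coprime_sym coprimeXl //; rewrite prime_coprime //.
    rewrite (_ : 24 = 2 ^ 3 * 3) // Euclid_dvdM // Euclid_dvdX //.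
    by rewrite !gtnNdvd //; lia.
  move=> n; have := @exactly_divides_mod p (p ^ 2) 1 0 n (dvdnn _).
  by rewrite !mul1n !addn0 => ->.
- by move=> n; rewrite good_per.
move=> n; congr nat_of_bool; apply: eq_in_all => q q_ps; apply: good_per.
by rewrite (big_rem q) //= dvdn_mulr.
Qed.
End Sieve.

(** * Density one *)

Lemma harmonic_unbounded (R : realType) (B : R) :
  exists x, B < \sum_(k < x) k.+1%:R^-1.
Proof.
apply: contrapT => bounded; apply: (@dvg_harmonic R).
apply: nondecreasing_is_cvgn.
  by apply: nondecreasing_series => n _ _; exact: harmonic_ge0.
exists B => _ [x _ <-]; rewrite /series /= big_mkord leNgt; apply/negP => lt_B.
by apply: bounded; exists x.
Qed.

(** With u = 1/p, the inequality (1 - u + u^2)^4 <= (1 - u) / (1 + u) for small u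
    compares the sieve density with the products that dominate the harmonic
    series. *)
Lemma inert_product_small (R : realType) (e : R) : 0 < e ->
  exists ps, [/\ uniq ps, all prime ps, all (leq 5) ps, all (fun p => p %% 3 == 2)%N ps
    & \prod_(p <- ps) (1 - p%:R^-1 + p%:R^-1 ^+ 2) < e].
Proof.
move=> e_gt0; have [x Hx] := harmonic_unbounded (6 / e ^+ 4).
pose ps := [seq p <- iota 5 x | prime p && (p %% 3 == 2)%N].
have psP p : p \in ps -> [/\ prime p, (5 <= p)%N & (p %% 3 = 2)%N].
  by rewrite mem_filter mem_iota => /andP[/andP[? /eqP ?] /andP[? _]].
have ps_uniq : uniq ps by rewrite filter_uniq ?iota_uniq.
exists ps; split=> //; try by apply/allP => p /psP[] // _ _ ->.
(* The primes 2 and 3 contribute 3 and 2 to the bound, the constant factor 6. *)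
have qs_uniq : uniq [:: 2, 3 & ps]%N.
  by rewrite /= inE ps_uniq andbT; apply/andP; split; apply/negP => /psP[].
have qs_prime : all prime [:: 2, 3 & ps]%N.
  by apply/allP => p; rewrite !inE => /or3P[/eqP->|/eqP->|/psP[]].
have qs_ns : all (fun p => p %% 3 != 1)%N [:: 2, 3 & ps]%N.
  by apply/allP => p; rewrite !inE => /or3P[/eqP->|/eqP->|/psP[_ _ ->]].
have := chi3_sum_le R x qs_uniq qs_prime qs_ns.
rewrite chi3_sum_harmonic; last first.
  move=> p p_pr le_px p_ns; rewrite !inE mem_filter mem_iota p_pr /=.
  have dvd3 : (3 %| p)%N -> p = 3%N by rewrite dvdn_prime2 // => /eqP.
  have p_neq4 : p != 4%N by apply: contraTneq p_pr => ->.
  by have := prime_gt1 p_pr; lia.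
rewrite !big_cons; set P := \prod_(p <- _) _ => H6.
have {H6} : \sum_(k < x) k.+1%:R^-1 <= 6 * P.
  apply: le_trans H6 _; rewrite le_eqVlt; apply/orP; left; apply/eqP.
  by rewrite mulrA; congr (_ * _); field.
move=> H6; have {Hx}{}H6 := lt_le_trans Hx H6.
set Q := \prod_(p <- ps) _.
have [Q_ge0 QP] : 0 <= Q /\ Q ^+ 4 * P <= 1.
  rewrite /Q /P -prodrXl -big_split /= !big_seq; split.
    apply: prodr_ge0 => p /psP[_ p_ge5 _].
    have : 0 <= p%:R^-1 :> R by rewrite invr_ge0. 
    by set u := p%:R^-1; nra.
  apply: prodr_ile1 => p /psP[_ p_ge5 _].
  have : 0 < p%:R^-1 :> R by rewrite invr_gt0 ltr0n; lia.
  have : p%:R^-1 <= 5^-1 :> R by rewrite lef_pV2 ?posrE ?ltr0n ?ler_nat //; lia.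
  move: (p%:R^-1) => u u_le u_gt0.
  have s1 : (1 - u + u ^+ 2) ^+ 2 <= 1 - u by nra.
  have s2 : (1 - u + u ^+ 2) ^+ 4 * (1 + u) <= 1 - u.
    rewrite (exprM _ 2 2); move: (_ ^+ 2) s1 (sqr_ge0 (1 - u + u ^+ 2)) => v v_le v_ge0.
    by nra.
  rewrite mulrA ler_pdivrMr ?mul1r ?s2; last by lra.
  rewrite andbT; apply: divr_ge0; last by lra.
  by apply: mulr_ge0; [rewrite exprn_even_ge0 | lra].
have Q4 : Q ^+ 4 < e ^+ 4.
  have e4 : 0 < e ^+ 4 by rewrite exprn_gt0.
  move: H6; rewrite ltr_pdivrMr // => H6.
  have P_gt0 : 0 < P by nra.
  rewrite -(ltr_pM2r P_gt0); apply: le_lt_trans QP _.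
  by nra.
by rewrite ltr_pXn2r ?nnegrE // in Q4; exact: ltW.
Qed.

(** Every n with EObar(8 n + 6) not divisible by 8 survives the sieve, and the
    interval below x is covered by x / M + 1 periods. *)
Lemma sieve_bound ps x : uniq ps -> all prime ps -> all (leq 5) ps ->
  all (fun p => p %% 3 == 2)%N ps ->
  (\sum_(n < x) (EObar (8 * n + 6) %% 8 != 0) <=
   (x %/ \prod_(p <- ps) p ^ 2).+1 * \prod_(p <- ps) (p ^ 2 - p + 1))%N.
Proof.
move=> ps_uniq ps_prime ps_ge5 ps_mod3.
set M := (\prod_(p <- ps) p ^ 2)%N.
pose good n := all (fun p => ~~ exactly_divides p (24 * n + 19)) ps.
have M_gt0 : (0 < M)%N.
  rewrite /M big_seq prodn_cond_gt0 // => p /(allP ps_prime)/prime_gt0 p_gt0.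
  by rewrite expn_gt0 p_gt0.
have bad_good n : (EObar (8 * n + 6) %% 8 != 0)%N -> good n.
  move=> /not_dvd8_EObar[a [b E]]; apply/allP => p p_ps.
  rewrite E /exactly_divides negb_and negbK -implybE; apply/implyP.
  apply: inert_dvd_form; [exact: (allP ps_prime) | exact: (allP ps_ge5) |].
  exact/eqP/(allP ps_mod3 _ p_ps).
apply: (@leq_trans (\sum_(n < x) good n)).
  by apply: leq_sum => n _; case: (boolP (_ != _)) => // /bad_good ->.
have le_xM : (x <= (x %/ M).+1 * M)%N by rewrite ltnW // ltn_ceil.
apply: (@leq_trans (\sum_(n < (x %/ M).+1 * M) good n)).
  by rewrite -(subnKC le_xM) big_split_ord /= leq_addr.
rewrite (@sum_blocks _ M (fun n => good n : nat)) -(sieve_count ps_uniq ps_prime ps_ge5).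
rewrite -/M -[X in (_ <= X * _)%N](card_ord (x %/ M).+1) -sum_nat_const.
apply: leq_sum => i _; apply: eq_leq; apply: eq_bigr => j _; congr nat_of_bool.
apply: eq_in_all => p p_ps; congr negb.
have pM : (p ^ 2 %| M)%N by rewrite /M (big_rem p) //= dvdn_mulr.
rewrite -(exactly_divides_mod 24 19 (M * i + j) pM).
by rewrite [(M * i)%N]mulnC modnMDl exactly_divides_mod.
Qed.

Lemma count_uptoE (R : realType) (X : R) (b : pred nat) : 0 <= X ->
  count_upto (fun n => b n) X = (\sum_(n < (Num.truncn X).+1) b n)%N.
Proof.
move=> X_ge0; rewrite /count_upto.
set s := [seq n <- iota 0 (Num.truncn X).+1 | b n].
have mem_s n : (n \in seq_fset tt s) = (n%:R <= X) && b n.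
  rewrite seq_fsetE mem_filter mem_iota /= add0n ltnS truncn_ge_nat //.
  by rewrite andbC.
have -> : [set n : nat | n%:R <= X /\ b n] = [set` seq_fset tt s].
  by apply/seteqP; split=> n /=; rewrite mem_s => /andP.
rewrite set_fsetK size_seq_fset undup_id ?filter_uniq ?iota_uniq // size_filter.
have -> : iota 0 (Num.truncn X).+1 = index_iota 0 (Num.truncn X).+1.
  by rewrite /index_iota subn0.
by rewrite -sum1_count big_mkcond big_mkord; apply: eq_bigr => n _; case: (b n).
Qed.

Theorem theorem1p5 (R : realType) :
  (fun X : R =>
     (count_upto (fun n : nat => (EObar (8 * n + 6) = 0 %[mod 8])%N) X)%:R / X)
    @ +oo --> (1 : R).
Proof.
pose bad n := (EObar (8 * n + 6) %% 8 != 0)%N.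
have countE (X : R) : 0 <= X ->
    (count_upto (fun n : nat => (EObar (8 * n + 6) = 0 %[mod 8])%N) X)%:R
    = (Num.truncn X).+1%:R - (\sum_(n < (Num.truncn X).+1) bad n)%N%:R :> R.
  move=> X_ge0.
  have -> : (fun n : nat => (EObar (8 * n + 6) = 0 %[mod 8])%N)
          = (fun n => ~~ bad n : Prop).
    apply/funext => n; apply/propext; rewrite /bad negbK mod0n.
    by split=> [->//|/eqP].
  rewrite count_uptoE //; apply/eqP; rewrite eq_sym subr_eq -natrD -big_split /=; apply/eqP.
  congr _%:R; rewrite -[LHS](card_ord _) -sum1_card; apply: eq_bigr => n _.
  by case: bad.
apply/cvgrPdist_lt => e e_gt0.
have [|ps [ps_uniq ps_prime ps_ge5 ps_mod3 ps_small]] := @inert_product_small R (e / 2).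
  by rewrite divr_gt0.
pose M := (\prod_(p <- ps) p ^ 2)%N; pose C := (\prod_(p <- ps) (p ^ 2 - p + 1))%N.
set d := \prod_(p <- ps) _ in ps_small.
have M_gt0 : 0 < M%:R :> R.
  rewrite ltr0n /M big_seq prodn_cond_gt0 // => p /(allP ps_prime)/prime_gt0 p_gt0.
  by rewrite expn_gt0 p_gt0.
have CE : C%:R = M%:R * d.
  rewrite /C /M /d !natr_prod -big_split /= big_seq [RHS]big_seq.
  apply: eq_bigr => p /(allP ps_prime)/prime_gt0 p_gt0.
  rewrite natrD natrB ?natrX; last by rewrite expnS leq_pmulr // expn1.
  have : p%:R != 0 :> R by rewrite pnatr_eq0; lia.
  by move=> p_neq0; field.
have d_ge0 : 0 <= d by rewrite -(pmulr_rge0 _ M_gt0) -CE ler0n.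
near=> X.
have X_gt0 : 0 < X by near: X; apply: nbhs_pinfty_gt; rewrite num_real.
have X_large : 2 * (C%:R + e + 1) / e <= X.
  by near: X; apply: nbhs_pinfty_ge; rewrite num_real.
have {}X_large : C%:R + e + 1 <= e / 2 * X.
  by move: X_large; rewrite ler_pdivrMr // => ?; lra.
rewrite countE ?ltW //; set x := (Num.truncn X).+1.
have [xX Xx] : x%:R <= X + 1 /\ X <= x%:R.
  have /andP[h1 h2] := truncn_itv (ltW X_gt0).
  by rewrite /x; split; [rewrite -natr1 lerD2r | exact: ltW].
set B := (\sum_(n < x) _)%N.
have B_le : B%:R <= x%:R * d + C%:R.
  have h := sieve_bound x ps_uniq ps_prime ps_ge5 ps_mod3.
  have : B%:R <= ((x %/ M).+1 * C)%N%:R :> R by rewrite ler_nat.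
  rewrite natrM -natr1 mulrDl mul1r => /le_trans; apply.
  rewrite lerD2r CE mulrA ler_wpM2r //.
  by rewrite -natrM ler_nat leq_trunc_div.
have -> : 1 - (x%:R - B%:R) / X = (X - x%:R + B%:R) / X by field; rewrite gt_eqF.
rewrite normf_div (gtr0_norm X_gt0) ltr_pdivrMr // ltr_norml.
have B_ge0 : 0 <= B%:R :> R by [].
have C_ge0 : 0 <= C%:R :> R by [].
have xd : x%:R * d <= (X + 1) * (e / 2) by apply: ler_pM => //; lra.
apply/andP; split; lra.
Unshelve. all: by end_near.
Qed.
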